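(* Let $1\le p<\infty$ and $\alpha>-2$. Let $\mu$ be a finite positive Borel measure on $[0,1)$. The Cesàro-like operator $\mathcal{C}_\mu$ is bounded on $AT_p^\infty(\alpha)$ if and only if $\mu$ is a Carleson measure.
   Context: $\mathbb{D}$ is the open unit disk in $\mathbb{C}$, $\mathbb{T}$ its boundary, $H(\mathbb{D})$ the set of analytic functions on $\mathbb{D}$, and $dA=\frac1\pi\,dx\,dy$ the normalized area measure on $\mathbb{D}$. Fix $\zeta>\frac12$ and for $\eta\in\mathbb{T}$ let $\Gamma(\eta)=\Gamma_\zeta(\eta)=\{z\in\mathbb{D}:|z-\eta|<\zeta(1-|z|^2)\}$. For $re^{i\theta}\in\mathbb{D}\setminus\{0\}$ let $S(re^{i\theta})=\{\lambda e^{it}:|t-\theta|\le\frac{1-r}{2},\ 1-\lambda\le 1-r\}$ (a subset of $\mathbb{D}$), and $S(0)=\mathbb{D}$. For $0<p<\infty$, the tent space $T_p^\infty(\alpha)$ consists of all measurable functions $f$ on $\mathbb{D}$ with $$\|f\|_{T_p^\infty(\alpha)}^p=\operatorname*{ess\,sup}_{\eta\in\mathbb{T}}\left(\sup_{u\in\Gamma(\eta)}\frac{1}{1-|u|^2}\int_{S(u)}|f(z)|^p(1-|z|^2)^{\alpha+1}\,dA(z)\right)<\infty.$$ The Hardy-Carleson type tent space is $AT_p^\infty(\alpha)=T_p^\infty(\alpha)\cap H(\mathbb{D})$, with $\|f\|_{AT_p^\infty(\alpha)}=\|f\|_{T_p^\infty(\alpha)}$. For a finite positive Borel measure $\mu$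 on $[0,1)$ with moments $\mu_n=\int_0^1t^n\,d\mu(t)$, the Cesàro-like operator $\mathcal{C}_\mu$ is defined for $f(z)=\sum_{n\ge0}a_nz^n\in H(\mathbb{D})$ by $$\mathcal{C}_\mu(f)(z)=\sum_{n=0}^\infty\left(\mu_n\sum_{k=0}^na_k\right)z^n=\int_0^1\frac{f(tz)}{1-tz}\,d\mu(t),\quad z\in\mathbb{D}.$$ The measure $\mu$ on $[0,1)$ is a Carleson measure (i.e. $1$-Carleson measure) if there is a constant $C>0$ such that $\mu([t,1))\le C(1-t)$ for all $0\le t<1$. *)

(* Defs.v *)
From mathcomp Require Import all_boot all_order all_algebra.
From mathcomp Require Import all_classical all_reals all_analysis.
From mathcomp Require Import ess_sup_inf.
From mathcomp Require Import complex.

Set Implicit Arguments.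
Unset Strict Implicit.
Unset Printing Implicit Defensive.

Import Order.TTheory GRing.Theory Num.Theory.
Import numFieldNormedType.Exports.

Local Open Scope classical_set_scope.
Local Open Scope ring_scope.
Local Open Scope complex_scope.

Section Defs.
Context {R : realType}.
Local Notation C := (R[i]).

(* The norm `|z| of R[i] takes its values in R[i]; this one is real-valued. *)
Definition cabs (z : C) : R := Normc.normc z.

Definition cis (t : R) : C := cos t +i* sin t.

Definition disk : set C := [set z | cabs z < 1].

Definition R2C (w : R * R) : C := w.1 +i* w.2.

(* The regular algebra C^o carries the topology of the norm. *)
Definition has_sum (u : nat -> C) (l : C) : Prop :=
  series (u : nat -> C^o) @ \oo --> (l : C^o).

(* Functions on the disk are total functions C -> C; no definition below
   depends on their values off the disk. *)
Definition analytic_at (f : C -> C) (z0 : C) : Prop :=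
  exists (a : nat -> C) (r : R), 0 < r /\
    forall z, cabs (z - z0) < r -> has_sum (fun n => a n * (z - z0) ^+ n) (f z).

Definition analytic_on_disk (f : C -> C) : Prop :=
  forall z, disk z -> analytic_at f z.

Definition measurable_on_disk (f : C -> C) : Prop :=
  measurable_fun (R2C @^-1` disk) (fun w => complex.Re (f (R2C w))) /\
  measurable_fun (R2C @^-1` disk) (fun w => complex.Im (f (R2C w))).

Definition area_integral (E : set C) (g : C -> \bar R) : \bar R :=
  ((pi^-1)%:E *
   \int[(@lebesgue_measure R \x @lebesgue_measure R)%E]_(w in R2C @^-1` E)
     g (R2C w))%E.

Definition Gamma (zeta : R) (eta : C) : set C :=
  [set z | disk z /\ cabs (z - eta) < zeta * (1 - cabs z ^+ 2)].

(* theta ranges over all arguments of u; by 2 pi-periodicity of cis each of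
   them gives the same points. *)
Definition Sbox (u : C) : set C :=
  if u == 0 then disk else
  [set z | exists theta lambda t : R,
     [/\ u = (cabs u)%:C * cis theta,
         `|t - theta| <= (1 - cabs u) / 2,
         1 - lambda <= 1 - cabs u,
         lambda < 1 &
         z = lambda%:C * cis t]].

Definition tent_sup (zeta p alpha : R) (f : C -> C) (eta : C) : \bar R :=
  ereal_sup [set ((1 - cabs u ^+ 2)^-1%:E *
      area_integral (Sbox u)
        (fun z => (cabs (f z) `^ p * (1 - cabs z ^+ 2) `^ (alpha + 1))%:E))%E
    | u in Gamma zeta eta].

(* The unit circle with arc length is parametrized by [0, 2 pi]. *)
Definition circle_ess_sup (g : C -> \bar R) : \bar R :=
  ess_sup (mrestr (@lebesgue_measure R) (measurable_itv `[0, 2 * pi]))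
    (fun theta => g (cis theta)).

Definition tent_norm (zeta p alpha : R) (f : C -> C) : \bar R :=
  (circle_ess_sup (tent_sup zeta p alpha f) `^ p^-1)%E.

Definition tent_space (zeta p alpha : R) : set (C -> C) :=
  [set f | measurable_on_disk f /\ (tent_norm zeta p alpha f < +oo)%E].

Definition analytic_tent_space (zeta p alpha : R) : set (C -> C) :=
  tent_space zeta p alpha `&` analytic_on_disk.

(* For f analytic on the disk this picks its unique coefficient sequence. *)
Definition taylor_coef (f : C -> C) : nat -> C :=
  xget (fun=> 0)
    [set a | forall z, disk z -> has_sum (fun n => a n * z ^+ n) (f z)].

Definition moment (mu : {measure set (measurableTypeR R) -> \bar R}) (n : nat) : R :=
  \int[mu]_(t in `[0, 1[) (t ^+ n).

Definition cesaro_like (mu : {measure set (measurableTypeR R) -> \bar R})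
    (f : C -> C) (z : C) : C :=
  lim (series (fun n => (moment mu n)%:C *
                 (\sum_(k < n.+1) taylor_coef f k) * z ^+ n : C^o) @ \oo).

Definition bounded_on_AT (zeta p alpha : R) (T : (C -> C) -> C -> C) : Prop :=
  exists M : R, forall f, analytic_tent_space zeta p alpha f ->
    analytic_tent_space zeta p alpha (T f) /\
    (tent_norm zeta p alpha (T f) <= M%:E * tent_norm zeta p alpha f)%E.

Definition carleson (mu : {measure set (measurableTypeR R) -> \bar R}) : Prop :=
  exists2 M : R, 0 < M &
    forall t : R, 0 <= t < 1 -> (mu `[t, 1%R[%classic <= (M * (1 - t))%:E)%E.

End Defs.

(* Main.v *)
Require Import Defs.
From mathcomp Require Import all_boot all_order all_algebra.
From mathcomp Require Import all_classical all_reals all_analysis.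
From mathcomp Require Import complex.
From mathcomp Require Import measurable_realfun ess_sup_inf.
From mathcomp Require Import ring lra.

Set Implicit Arguments.
Unset Strict Implicit.
Unset Printing Implicit Defensive.

Import Order.TTheory GRing.Theory Num.Theory.
Import numFieldNormedType.Exports.

Local Open Scope classical_set_scope.
Local Open Scope ring_scope.

(** Write d = 1 - |z|, y = Im z and c = (alpha + 2) / p. Two facts about the
tent space carry the proof; they are almost converse to each other.

Growth ([tent_growth]): |f(z)| <= A ||f|| d^(-c) for analytic f. Since p >= 1,
|f|^p has the sub-mean value property ([subharmonic_cdisc]). The disk of centre
z and radius d / 4 lies in a box whose corner is at distance 2 d from the
circle, on which the weighted integral of |f|^p is O(d ||f||^p), while the
weight is comparable to d^(alpha+1) on the disk. Hence
|f(z)|^p d^2 d^(alpha+1) = O(d ||f||^p). When zeta is close to 1/2 the approach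
regions contain only points close to the circle, so this covers z near the
circle; Cauchy's estimates do the rest.

Majorant ([tent_norm_majorant]): if |f(z)| <= L d^(b-c) |y|^(-b) for a small
b > 0, then ||f|| = O(L). Indeed, with e = p b, the p-th power of this bound
times the weight is O(d^(e-1) |y|^(-e)), and the integral of that function over
a box of size h is O(h), as both exponents are above -1 ([box_integral_le]).

Sufficiency. In C_mu f(z) = \int f(t z) / (1 - t z) dmu(t) only the growth of f
matters: |f(t z)| <= A ||f|| (1 - t|z|)^(-c), and since |1 - t z| is at least
1 - t|z| and at least |y| / 2, its inverse is at most
(1 - t|z|)^(b-1) (|y| / 2)^(-b). A Carleson measure integrates
(1 - t|z|)^(-(c+1-b)) to O(d^(b-c)), so that C_mu f satisfies the majorant
condition with L = O(||f||) ([cesaro_norm_le], [carleson_bounded]).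

Necessity. For an integer s > c the functions
f_t(z) = (1 - t)^(s-c) (1 - t z)^(-s) are dominated by |1 - t z|^(-c), so their
norms are bounded uniformly in t by the majorant condition. Their Taylor
coefficients are nonnegative and the n-th moment of mu is at least
t^n mu([t, 1)), whence C_mu f_t(t) >= mu([t, 1)) f_t(t^2) / (1 - t^2), which is
of order mu([t, 1)) (1 - t)^(-c-1). The growth estimate at z = t bounds it by
O((1 - t)^(-c)) ([cesaro_test_ge], [bounded_carleson]).

The complex analysis behind this is done by hand on power series: Cauchy's
estimates come from averaging over roots of unity, and the mean value property
over disks from Green's formula for polynomials. Area integrals are computed in
Cartesian coordinates, by Tonelli's theorem. *)

(** * Modulus of complex numbers *)

Section ComplexModulus.
Local Open Scope complex_scope.
Context {R : realType}.
Local Notation C := (R[i]).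
Implicit Types z w : C.

Lemma cabsE z : `|z| = (cabs z)%:C.
Proof. by rewrite normc_def; case: z. Qed.

Lemma cabs_ge0 z : 0 <= cabs z.
Proof. by case: z => a b; rewrite /cabs /= sqrtr_ge0. Qed.

Lemma cabs0 : cabs (0 : C) = 0. Proof. exact: Normc.normc0. Qed.
Lemma cabs1 : cabs (1 : C) = 1. Proof. exact: Normc.normc1. Qed.

Lemma cabs_eq0 z : (cabs z == 0) = (z == 0).
Proof.
by apply/eqP/eqP => [/Normc.eq0_normc//|->]; rewrite cabs0.
Qed.

Lemma cabs_gt0 z : (0 < cabs z) = (z != 0).
Proof. by rewrite lt_neqAle cabs_ge0 andbT eq_sym cabs_eq0. Qed.

Lemma cabsM z w : cabs (z * w) = cabs z * cabs w.
Proof. exact: Normc.normcM. Qed.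

Lemma cabsD z w : cabs (z + w) <= cabs z + cabs w.
Proof. exact: le_normcD. Qed.

Lemma cabsN z : cabs (- z) = cabs z.
Proof. exact: normcN. Qed.

Lemma cabsB z w : cabs (z - w) = cabs (w - z).
Proof. by rewrite -cabsN opprB. Qed.

Lemma cabsV z : cabs z^-1 = (cabs z)^-1.
Proof. exact: Normc.normcV. Qed.

Lemma cabsX z n : cabs (z ^+ n) = cabs z ^+ n.
Proof. by elim: n => [|n IH]; rewrite ?expr0 ?cabs1// !exprS cabsM IH. Qed.

Lemma cabs_real (x : R) : cabs x%:C = `|x|.
Proof. by rewrite /cabs /= expr0n /= addr0 sqrtr_sqr. Qed.

Lemma cabs_nat n : cabs (n%:R : C) = n%:R.
Proof.
by rewrite (_ : n%:R = (n%:R)%:C) ?cabs_real ?ger0_norm// rmorph_nat.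
Qed.

Lemma cabs_sum (I : Type) (r : seq I) (P : pred I) (F : I -> C) :
  cabs (\sum_(i <- r | P i) F i) <= \sum_(i <- r | P i) cabs (F i).
Proof.
apply: (big_ind2 (fun a b => cabs a <= b)); first by rewrite cabs0.
- by move=> a b c d ab cd; apply: le_trans (cabsD _ _) _; apply: lerD.
- by [].
Qed.

Lemma cabs_distD z w : cabs z - cabs w <= cabs (z - w).
Proof. by rewrite lerBlDr; apply: le_trans _ (cabsD _ _); rewrite subrK. Qed.

Lemma sqr_cabs z : cabs z ^+ 2 = complex.Re z ^+ 2 + complex.Im z ^+ 2.
Proof.
by case: z => a b; rewrite /cabs /= sqr_sqrtr// addr_ge0// sqr_ge0.
Qed.

Lemma Re_le_cabs z : `|complex.Re z| <= cabs z.
Proof.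
rewrite -(ler_pXn2r (n:=2)) ?nnegrE ?cabs_ge0// sqr_cabs real_normK ?num_real//.
by rewrite lerDl sqr_ge0.
Qed.

Lemma Im_le_cabs z : `|complex.Im z| <= cabs z.
Proof.
rewrite -(ler_pXn2r (n:=2)) ?nnegrE ?cabs_ge0// sqr_cabs real_normK ?num_real//.
by rewrite lerDr sqr_ge0.
Qed.

Lemma cabs_le_ReIm z : cabs z <= `|complex.Re z| + `|complex.Im z|.
Proof.
rewrite -(ler_pXn2r (n:=2)) ?nnegrE ?cabs_ge0 ?addr_ge0// sqr_cabs sqrrD.
by rewrite !real_normK ?num_real// lerD2r lerDl mulrn_wge0 ?mulr_ge0.
Qed.

Lemma ReD z w : complex.Re (z + w) = complex.Re z + complex.Re w.
Proof. by case: z; case: w. Qed.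
Lemma ImD z w : complex.Im (z + w) = complex.Im z + complex.Im w.
Proof. by case: z; case: w. Qed.

Lemma Re_sum (I : Type) (r : seq I) (P : pred I) (F : I -> C) :
  complex.Re (\sum_(i <- r | P i) F i) = \sum_(i <- r | P i) complex.Re (F i).
Proof. by apply: (big_morph _ ReD). Qed.

Lemma Im_sum (I : Type) (r : seq I) (P : pred I) (F : I -> C) :
  complex.Im (\sum_(i <- r | P i) F i) = \sum_(i <- r | P i) complex.Im (F i).
Proof. by apply: (big_morph _ ImD). Qed.

Lemma Re_realM (x : R) z : complex.Re (x%:C * z) = x * complex.Re z.
Proof. by case: z => a b /=; rewrite mul0r subr0. Qed.

(** Multiplying by a unimodular number turns a modulus into a real part; this
is how inequalities between complex integrals are reduced to real ones. *)
Lemma cabs_rot z : exists2 w, cabs w = 1 & complex.Re (w * z) = cabs z.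
Proof.
have [->|z0] := eqVneq z 0; first by exists 1; rewrite ?cabs1// mulr0 cabs0.
exists ((cabs z)%:C / z).
  by rewrite cabsM cabsV cabs_real ger0_norm ?cabs_ge0// divff// cabs_eq0.
by rewrite divfK.
Qed.

End ComplexModulus.

(** * Summation of complex series *)

Section HasSum.
Local Open Scope complex_scope.
Context {R : realType}.
Local Notation C := (R[i]).
Implicit Types (u v : nat -> C) (l : C).

Lemma has_sumP u l : has_sum u l <->
  forall e : R, 0 < e -> exists N, forall n, (N <= n)%N ->
    cabs (\sum_(k < n) u k - l) < e.
Proof.
split=> [/cvgrPdist_lt h e e0|h].
  have /h [N _ hN] : 0 < e%:C :> C by rewrite ltcR.
  exists N => n Nn; have := hN n Nn.
  by rewrite /series /= big_mkord cabsE ltcR cabsB.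
apply/cvgrPdist_lt => e e0.
have er : e = (complex.Re e)%:C.
  by rewrite RRe_real// gtr0_real.
have [N hN] := h (complex.Re e) ltac:(by rewrite -ltcR -er).
exists N => // n /hN; rewrite /series /= big_mkord cabsE cabsB => hh.
by rewrite er ltcR.
Qed.

End HasSum.

Section Geometric.
Local Open Scope complex_scope.
Context {R : realType}.

Lemma geo_sum_le (th : R) n : 0 <= th -> th < 1 ->
  \sum_(k < n) th ^+ k <= (1 - th)^-1.
Proof.
move=> th0 th1.
have h : \sum_(k < n) th ^+ k = (1 - th ^+ n) / (1 - th).
  have t1 : 1 - th != 0 by rewrite subr_eq0 eq_sym lt_eqF.
  apply: (mulIf t1); rewrite divfK//.
  have := subrX1 th n; rewrite mulrC => /(congr1 -%R).
  by rewrite opprB -mulrN opprB.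
rewrite h -[leRHS]mul1r ler_pM2r ?invr_gt0 ?subr_gt0//.
by rewrite gerBl exprn_ge0.
Qed.

Lemma geo_small (th K e : R) : 0 <= th -> th < 1 -> 0 < e ->
  exists N, forall n, (N <= n)%N -> K * th ^+ n < e.
Proof.
move=> th0 th1 e0.
have /cvgrPdist_lt : geometric K th @ \oo --> 0.
  by apply: cvg_geometric; rewrite ger0_norm.
move=> /(_ _ e0) [N _ hN]; exists N => n /hN /=.
by rewrite sub0r normrN; apply: le_lt_trans; rewrite ler_norm.
Qed.

Lemma le_geo_limit (x y th K : R) : 0 <= th -> th < 1 ->
  (forall n, x <= y + K * th ^+ n) -> x <= y.
Proof.
move=> th0 th1 h; apply/ler_addgt0Pr => e e0.
have [N hN] := geo_small K th0 th1 e0.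
by apply: le_trans (h N) _; rewrite lerD2l ltW// hN.
Qed.

End Geometric.

Section HasSumTheory.
Local Open Scope complex_scope.
Context {R : realType}.
Local Notation C := (R[i]).
Implicit Types (u v : nat -> C) (l : C).

Lemma has_sum_lim u l : has_sum u l ->
  lim (series (u : nat -> C^o) @ \oo) = l.
Proof. by move=> h; apply/cvg_lim => //; exact: norm_hausdorff. Qed.

Lemma has_sum_unique u l l' : has_sum u l -> has_sum u l' -> l = l'.
Proof. by move=> /has_sum_lim <- /has_sum_lim <-. Qed.

Lemma eq_has_sum u v l : u =1 v -> has_sum u l -> has_sum v l.
Proof. by move=> /funext ->. Qed.

Lemma has_sum0 : has_sum (fun=> 0) (0 : C).
Proof.
apply/has_sumP => e e0; exists 0%N => n _.
by rewrite big1// subr0 cabs0.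
Qed.

Lemma has_sumD u v l m : has_sum u l -> has_sum v m ->
  has_sum (fun n => u n + v n) (l + m).
Proof.
move=> /has_sumP hu /has_sumP hv; apply/has_sumP => e e0.
have e2 : 0 < e / 2 by rewrite divr_gt0.
have [N1 h1] := hu _ e2; have [N2 h2] := hv _ e2.
exists (maxn N1 N2) => n; rewrite geq_max => /andP[n1 n2].
rewrite big_split /= opprD addrACA.
apply: le_lt_trans (cabsD _ _) _.
by rewrite (splitr e) ltrD ?h1 ?h2.
Qed.

Lemma has_sumZ u l c : has_sum u l -> has_sum (fun n => c * u n) (c * l).
Proof.
move=> /has_sumP hu; apply/has_sumP => e e0.
have c1 : 0 < cabs c + 1 by rewrite ltr_wpDl ?cabs_ge0.
have [N hN] := hu _ (divr_gt0 e0 c1).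
exists N => n /hN; rewrite ltr_pdivlMr// => h.
rewrite -big_distrr -mulrBr cabsM mulrC; apply: le_lt_trans h.
by rewrite ler_wpM2l ?cabs_ge0// lerDl.
Qed.

Lemma has_sumB u v l m : has_sum u l -> has_sum v m ->
  has_sum (fun n => u n - v n) (l - m).
Proof.
move=> hu /(@has_sumZ _ _ (-1)) hv.
have := has_sumD hu hv; rewrite mulN1r; apply: eq_has_sum => n.
by rewrite mulN1r.
Qed.

Lemma has_sum_big (K : nat) (u : 'I_K -> nat -> C) (l : 'I_K -> C) :
  (forall k, has_sum (u k) (l k)) ->
  has_sum (fun n => \sum_(k < K) u k n) (\sum_(k < K) l k).
Proof.
elim: K u l => [|K IH] u l h.
  by rewrite big_ord0; apply: eq_has_sum has_sum0 => n; rewrite big_ord0.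
rewrite big_ord_recr.
have := has_sumD (IH (fun k => u (widen_ord (leqnSn K) k)) _ (fun k => h _))
  (h ord_max).
by apply: eq_has_sum => n; rewrite big_ord_recr.
Qed.

Lemma has_sum_norm_le u l (B : R) : has_sum u l ->
  (forall N, \sum_(n < N) cabs (u n) <= B) -> cabs l <= B.
Proof.
move=> /has_sumP hu hB; apply/ler_addgt0Pr => e e0.
have [N hN] := hu _ e0.
rewrite -(subrK (\sum_(k < N) u k) l) addrC.
apply: le_trans (cabsD _ _) _; apply: lerD.
  exact: le_trans (cabs_sum _ _ _) (hB N).
by rewrite cabsB ltW// hN.
Qed.

Lemma has_sum_shift u l N : has_sum u l ->
  has_sum (fun n => u (N + n)%N) (l - \sum_(k < N) u k).
Proof.
move=> /has_sumP hu; apply/has_sumP => e e0.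
have [M hM] := hu _ e0; exists M => n Mn.
have := hM (N + n)%N (leq_trans Mn (leq_addl _ _)).
by rewrite big_split_ord /= opprB addrCA addrA.
Qed.

Lemma has_sum_bounded u l : has_sum u l ->
  exists2 K : R, 0 <= K & forall n, cabs (u n) <= K.
Proof.
move=> /has_sumP /(_ 1 ltr01) [N hN].
exists (2 + \sum_(k < N) cabs (u k)).
  by rewrite addr_ge0// sumr_ge0// => i _; rewrite cabs_ge0.
move=> n; have [Nn|nN] := leqP N n.
  have := hN n.+1 (leqW Nn); have := hN n Nn.
  rewrite big_ord_recr /= => h1 h2.
  have -> : u n = (\sum_(k < n) u k + u n - l) - (\sum_(k < n) u k - l) by ring.
  apply: le_trans (cabsD _ _) _; rewrite cabsN.
  have : 0 <= \sum_(k < N) cabs (u k).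
    by rewrite sumr_ge0// => i _; rewrite cabs_ge0.
  lra.
rewrite (bigD1 (Ordinal nN)) //= addrA [2 + _]addrC -addrA lerDl addr_ge0//.
by rewrite sumr_ge0// => i _; rewrite cabs_ge0.
Qed.

Lemma has_sum_geo u (K th : R) : 0 <= th -> th < 1 -> 0 <= K ->
  (forall n, cabs (u n) <= K * th ^+ n) ->
  exists2 l, has_sum u l &
    forall N, cabs (l - \sum_(k < N) u k) <= K / (1 - th) * th ^+ N.
Proof.
move=> th0 th1 K0 hu.
(* Completeness is used on the real and on the imaginary parts. *)
have real_cvg (v : nat -> R) : (forall n, `|v n| <= cabs (u n)) ->
    exists l : R, forall e : R, 0 < e -> exists N, forall n, (N <= n)%N ->
      `|\sum_(k < n) v k - l| < e.
  move=> hv.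
  have /cvg_ex [l /cvgrPdist_lt hl] : cvgn (series v).
    apply: normed_cvg.
    apply: (@series_le_cvg R _ (geometric K th)) => [n|n|n|] /=.
    - by rewrite normr_ge0.
    - by rewrite mulr_ge0 ?exprn_ge0.
    - exact: le_trans (hv n) (hu n).
    - by apply: is_cvg_geometric_series; rewrite ger0_norm.
  exists l => e /hl [N _ hN]; exists N => n /hN.
  by rewrite /series /= big_mkord distrC.
have [x hx] := real_cvg (fun n => complex.Re (u n)) (fun n => Re_le_cabs _).
have [y hy] := real_cvg (fun n => complex.Im (u n)) (fun n => Im_le_cabs _).
have hl : has_sum u (x +i* y).
  apply/has_sumP => e e0; have e2 : 0 < e / 2 by rewrite divr_gt0.
  have [N1 h1] := hx _ e2; have [N2 h2] := hy _ e2.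
  exists (maxn N1 N2) => n; rewrite geq_max => /andP[/h1 n1 /h2 n2].
  apply: le_lt_trans (cabs_le_ReIm _) _; rewrite (splitr e).
  by rewrite ltrD // ?ReD ?ImD ?Re_sum ?Im_sum.
exists (x +i* y) => // N.
apply: (has_sum_norm_le (has_sum_shift (N := N) hl)) => M.
apply: (@le_trans _ _ (\sum_(n < M) K * th ^+ N * th ^+ n)).
  by apply: ler_sum => n _; rewrite -mulrA -exprD.
rewrite -mulr_sumr [leRHS]mulrAC.
by rewrite ler_wpM2l ?geo_sum_le// mulr_ge0 ?exprn_ge0.
Qed.

End HasSumTheory.

(** * Power series on the unit disk *)

Section DiskSeries.
Local Open Scope complex_scope.
Context {R : realType}.
Local Notation C := (R[i]).
Implicit Types (a : nat -> C) (f : C -> C).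

Lemma diskE z : @disk R z = (cabs z < 1) :> Prop.
Proof. by []. Qed.

Definition disk_expansion a f : Prop :=
  forall z, disk z -> has_sum (fun n => a n * z ^+ n) (f z).

(** Equivalent to a radius of convergence at least 1. In this form the property
passes to partial sums and to multiples by bounded sequences. *)
Definition subgeometric a : Prop :=
  forall rho : R, 0 < rho -> rho < 1 ->
    exists2 K, 0 <= K & forall n, cabs (a n) * rho ^+ n <= K.

Lemma disk_expansion_subgeometric a f : disk_expansion a f -> subgeometric a.
Proof.
move=> h rho rho0 rho1.
have ar : `|rho| = rho by rewrite gtr0_norm.
have [|K K0 hK] := has_sum_bounded (h rho%:C _).
  by rewrite diskE cabs_real ar.
by exists K => // n; have := hK n; rewrite cabsM cabsX cabs_real ar.
Qed.

Lemma subgeometric_le a (r : R) : subgeometric a -> 0 <= r -> r < 1 ->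
  exists K th : R, [/\ 0 <= K, 0 <= th, th < 1 &
    forall n, cabs (a n) * r ^+ n <= K * th ^+ n].
Proof.
move=> ha r0 r1.
(* Any radius strictly between r and 1 leaves a geometric margin. *)
pose rho := (1 + r) / 2.
have rho0 : 0 < rho by rewrite /rho; lra.
have rho1 : rho < 1 by rewrite /rho; lra.
have [K K0 hK] := ha _ rho0 rho1.
exists K, (r / rho); split => //.
- by rewrite divr_ge0// ltW.
- by rewrite ltr_pdivrMr// mul1r /rho; lra.
move=> n; rewrite expr_div_n mulrA ler_pdivlMr ?exprn_gt0//.
by rewrite mulrAC ler_wpM2r ?exprn_ge0.
Qed.

Lemma subgeometric_sum a z : subgeometric a -> disk z ->
  exists l, has_sum (fun n => a n * z ^+ n) l.
Proof.
move=> ha zd; have [K [th [K0 th0 th1 h]]] := subgeometric_le ha (cabs_ge0 z) zd.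
have [n|l hl _] := has_sum_geo (u := fun n => a n * z ^+ n) th0 th1 K0.
  by rewrite cabsM cabsX.
by exists l.
Qed.

(** The rate does not depend on z: integrals of f over sets inside the disk can
thus be replaced by integrals of polynomials, up to a geometric error. *)
Lemma disk_expansion_tail a f (r : R) : disk_expansion a f -> 0 <= r -> r < 1 ->
  exists K th : R, [/\ 0 <= K, 0 <= th, th < 1 & forall z, cabs z <= r ->
    forall N, cabs (f z - \sum_(n < N) a n * z ^+ n) <= K * th ^+ N].
Proof.
move=> h r0 r1; have ha := disk_expansion_subgeometric h.
have [K [th [K0 th0 th1 hK]]] := subgeometric_le ha r0 r1.
exists (K / (1 - th)), th; split=> //.
  by rewrite divr_ge0// subr_ge0 ltW.
move=> z zr N; have zd : disk z by exact: le_lt_trans r1.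
have [n|l hl ht] := has_sum_geo (u := fun n => a n * z ^+ n) th0 th1 K0.
  apply: le_trans (hK n); rewrite cabsM cabsX ler_wpM2l ?cabs_ge0//.
  by rewrite lerXn2r ?nnegrE ?cabs_ge0.
by rewrite (has_sum_unique (h _ zd) hl).
Qed.

Lemma subgeometricM a (m : nat -> R) (B : R) : subgeometric a ->
  (forall n, `|m n| <= B) -> subgeometric (fun n => (m n)%:C * a n).
Proof.
move=> ha hm rho r0 r1; have [K K0 hK] := ha _ r0 r1.
have B0 : 0 <= B by apply: le_trans (hm 0%N).
exists (B * K); first exact: mulr_ge0.
move=> n; rewrite cabsM cabs_real -mulrA ler_pM ?mulr_ge0 ?cabs_ge0//.
by rewrite exprn_ge0// ltW.
Qed.

Lemma subgeometric_partial_sums a : subgeometric a ->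
  subgeometric (fun n => \sum_(k < n.+1) a k).
Proof.
move=> ha rho r0 r1; have [K K0 hK] := ha _ r0 r1.
exists (K * (1 - rho)^-1); first by rewrite mulr_ge0 // invr_ge0 subr_ge0 ltW.
move=> n.
apply: (@le_trans _ _ (\sum_(k < n.+1) K * rho ^+ (n - k))).
  apply: (@le_trans _ _ ((\sum_(k < n.+1) cabs (a k)) * rho ^+ n)).
    by rewrite ler_wpM2r ?cabs_sum// exprn_ge0 // ltW.
  rewrite mulr_suml; apply: ler_sum => k _.
  have kn : (k <= n)%N by rewrite -ltnS.
  rewrite (_ : rho ^+ n = rho ^+ k * rho ^+ (n - k)); last by rewrite -exprD subnKC.
  by rewrite mulrA ler_wpM2r ?exprn_ge0// ltW.
rewrite -mulr_sumr ler_wpM2l//.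
rewrite (reindex_inj rev_ord_inj) /=.
rewrite (eq_bigr (fun k : 'I_n.+1 => rho ^+ k)) ?geo_sum_le ?ltW// => k _.
by rewrite subSS subKn// -ltnS.
Qed.

(** Cauchy product with the geometric series; in finite form, by Abel summation,
the N-th partial sums differ by a single term, which tends to 0. *)
Lemma disk_expansion_partial_sums a f : disk_expansion a f ->
  disk_expansion (fun n => \sum_(k < n.+1) a k) (fun z => f z / (1 - z)).
Proof.
move=> h z zd; have ha := disk_expansion_subgeometric h.
have hs := subgeometric_partial_sums ha.
have [l hl] := subgeometric_sum hs zd.
suff -> : f z = (1 - z) * l.
  rewrite mulrAC divff ?mul1r// subr_eq0; apply/eqP => z1.
  by move: zd; rewrite -z1 diskE cabs1 ltxx.
have h1 : forall N, \sum_(n < N) a n * z ^+ n =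
   (1 - z) * (\sum_(n < N) (\sum_(k < n.+1) a k) * z ^+ n) +
   (\sum_(k < N) a k) * z ^+ N.
  elim=> [|N IH]; first by rewrite !big_ord0 mulr0 mul0r addr0.
  rewrite [LHS]big_ord_recr IH [in RHS]big_ord_recr /= [\sum_(k < N.+1) a k]big_ord_recr /=.
  rewrite exprS; ring.
have [K [th [K0 th0 th1 hK]]] := subgeometric_le hs (cabs_ge0 z) zd.
apply: has_sum_unique (h _ zd) _; apply/has_sumP => e e0.
have e2 : 0 < e / 2 by rewrite divr_gt0.
have /has_sumP /(_ _ e2) [N1 hN1] := has_sumZ (c := 1 - z) hl.
have [N2 hN2] := geo_small K th0 th1 e2.
exists (maxn N1 N2.+1) => -[|n]; rewrite ?geq_max => /andP[n1 n2] //.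
rewrite h1 addrAC; apply: le_lt_trans (cabsD _ _) _; rewrite (splitr e) ltrD//.
  by have := hN1 _ n1; rewrite -big_distrr.
rewrite exprS mulrCA cabsM; apply: le_lt_trans _ (hN2 n n2).
apply: le_trans (hK n); rewrite cabsM cabsX -[leRHS]mul1r ler_pM ?mulr_ge0 ?cabs_ge0 ?exprn_ge0 ?cabs_ge0//.
exact: ltW.
Qed.

End DiskSeries.

(** * Roots of unity and Cauchy's estimates *)

Section UnitCircle.
Local Open Scope complex_scope.
Context {R : realType}.
Local Notation C := (R[i]).

Lemma cisD (s t : R) : cis (s + t) = cis s * cis t :> C.
Proof.
by rewrite /cis cosD sinD; apply/eqP; rewrite eq_complex /= eqxx addrC eqxx.
Qed.

Lemma cis0 : cis 0 = 1 :> C.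
Proof. by rewrite /cis cos0 sin0. Qed.

Lemma cabs_cis (t : R) : cabs (cis t) = 1.
Proof. by rewrite /cabs /= cos2Dsin2 sqrtr1. Qed.

Lemma cisX (t : R) n : cis t ^+ n = cis (n%:R * t) :> C.
Proof.
elim: n => [|n IH]; first by rewrite mul0r cis0.
by rewrite exprS IH -cisD -add1n natrD mulrDl mul1r.
Qed.

Lemma cis_neq1 (t : R) : 0 < t -> t < pi *+ 2 -> cis t != 1 :> C.
Proof.
move=> t0 t2; apply/eqP => -[ct _].
have : 0 < sin (t / 2).
  by apply: sin_gt0_pi; rewrite divr_gt0//= ltr_pdivrMr// mulr_natr.
(* cos t = 1 - 2 sin(t / 2)^2 *)
suff -> : sin (t / 2) = 0 by rewrite ltxx.
apply/eqP; rewrite -sqrf_eq0.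
have := cos2Dsin2 (t / 2); have := cosD (t / 2) (t / 2).
rewrite -splitr ct -!expr2 => h1 h2; apply/eqP.
lra.
Qed.

Lemma cis_prim_root N : (0 < N)%N -> exists2 w : C, N.-primitive_root w & cabs w = 1.
Proof.
move=> N0; have NR : 0 < N%:R :> R by rewrite ltr0n.
pose w : C := cis (pi *+ 2 / N%:R); exists w; last exact: cabs_cis.
have w1 : w ^+ N = 1.
  rewrite cisX mulrC divfK ?gt_eqF// /cis cos2pi.
  by rewrite mulr2n sinDpi sinpi oppr0.
have [m mw mN] := prim_order_exists N0 w1.
have m0 := prim_order_gt0 mw.
have := dvdn_leq N0 mN; rewrite leq_eqVlt => /predU1P[<-//|mN'].
have := prim_expr_order mw; rewrite cisX => /eqP cm; exfalso; move: cm.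
apply/negP; apply: cis_neq1.
  by rewrite mulr_gt0 ?ltr0n// divr_gt0// pmulrn_lgt0// pi_gt0.
rewrite mulrCA gtr_pMr; last by rewrite pmulrn_lgt0 ?pi_gt0.
by rewrite ltr_pdivrMr// mul1r ltr_nat.
Qed.

End UnitCircle.

Section Cauchy.
Local Open Scope complex_scope.
Context {R : realType}.
Local Notation C := (R[i]).
Implicit Types (a : nat -> C) (f : C -> C).

(** Averaging over the N-th roots of unity kills every power whose exponent is
not divisible by N. After multiplication by w^((N - n) j) the exponents are
N - n + k with k < N, and only k = n survives. *)
Lemma root_of_unity_average a (N n : nat) (w z : C) : N.-primitive_root w ->
  (n < N)%N ->
  \sum_(j < N) w ^+ ((N - n) * j) * (\sum_(k < N) a k * (z * w ^+ j) ^+ k) =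
  N%:R * (a n * z ^+ n).
Proof.
move=> pw nN.
under eq_bigr => j _ do rewrite mulr_sumr.
rewrite exchange_big /= (bigD1 (Ordinal nN)) //= [X in _ + X]big1 => [|k kn].
  rewrite addr0 (eq_bigr (fun=> a n * z ^+ n)) => [|j _].
    by rewrite sumr_const card_ord mulr_natl.
  rewrite exprMn -exprM mulrCA mulrA mulrA -mulrA -mulrA.
  rewrite [w ^+ _ * (_ * _)]mulrCA -exprD [(j * n)%N]mulnC -mulnDl subnK ?(ltnW nN)//.
  by rewrite exprM (prim_expr_order pw) expr1n mulr1.
pose x := w ^+ (N - n + k).
rewrite (eq_bigr (fun j : 'I_N => a k * z ^+ k * x ^+ j)) => [|j _].
  rewrite -mulr_sumr; suff -> : \sum_(j < N) x ^+ j = 0 by rewrite mulr0.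
  have : (x - 1) * (\sum_(j < N) x ^+ j) = 0.
    by rewrite -subrX1 /x -exprM mulnC exprM (prim_expr_order pw) expr1n subrr.
  move/eqP; rewrite mulf_eq0 => /orP[|/eqP//]; rewrite subr_eq0 => /eqP x1.
  move/eqP: x1; rewrite /x -(prim_order_dvd pw).
  move=> /dvdnP[q hq]; exfalso; move: kn; rewrite -val_eqE /= => /negP; apply.
  have kN := ltn_ord k; apply/eqP.
  case: q hq => [|[|q]] hq.
  - move: hq; rewrite mul0n => /eqP; rewrite addn_eq0 subn_eq0 leqNgt nN //.
  - apply/eqP; rewrite -(eqn_add2l (N - n)) subnK ?(ltnW nN)// hq mul1n //.
  - have : (2 * N <= N - n + k)%N by rewrite hq leq_mul2r orbC.
    rewrite leqNgt mul2n -addnn -ltnS => /negP; case; rewrite ltnS.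
    by rewrite -addnS leq_add// leq_subr.
rewrite /x exprMn -!exprM mulnDl exprD [(k * j)%N]mulnC; ring.
Qed.

(** The N-th partial sum, for large N, is close to f on the circle, and the
average above isolates its n-th coefficient. *)
Lemma cauchy_estimate a f (r B : R) n : disk_expansion a f -> 0 <= r -> r < 1 ->
  (forall z, cabs z = r -> cabs (f z) <= B) -> cabs (a n) * r ^+ n <= B.
Proof.
move=> h r0 r1 hB.
have [K [th [K0 th0 th1 hK]]] := disk_expansion_tail h r0 r1.
apply/ler_addgt0Pr => e e0.
have [M hM] := geo_small K th0 th1 e0.
pose N := (maxn M n.+1); have nN : (n < N)%N by rewrite /N leq_max leqnn orbT.
have [w pw w1] := @cis_prim_root R N (leq_ltn_trans (leq0n _) nN).
have NR : 0 < N%:R :> R by rewrite ltr0n (leq_ltn_trans _ nN).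
rewrite -(ler_pM2l NR).
have -> : N%:R * (cabs (a n) * r ^+ n) = cabs (N%:R * (a n * r%:C ^+ n)).
  by rewrite !cabsM cabs_nat cabsX cabs_real ger0_norm.
rewrite -(root_of_unity_average a r%:C pw nN).
apply: le_trans (cabs_sum _ _ _) _.
apply: (@le_trans _ _ (\sum_(j < N) (B + e))); last first.
  by rewrite sumr_const card_ord mulr_natl.
apply: ler_sum => j _; rewrite cabsM cabsX w1 expr1n mul1r.
set z := r%:C * w ^+ j.
have zr : cabs z = r by rewrite cabsM cabsX w1 expr1n mulr1 cabs_real ger0_norm.
rewrite -(subKr (f z) (\sum_(k < N) _)).
apply: le_trans (cabsD _ _) _; rewrite lerD ?hB// cabsN.
apply: le_trans (hK z _ N) _; rewrite ?zr// ltW// hM//.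
by rewrite leq_max leqnn.
Qed.

(** Cauchy's estimates for the difference, which sums to 0. *)
Lemma disk_expansion_unique a b f :
  disk_expansion a f -> disk_expansion b f -> a = b.
Proof.
move=> ha hb; apply/funext => n.
have h0 : disk_expansion (fun n => a n - b n) (fun=> 0).
  move=> z zd; have := has_sumB (ha _ zd) (hb _ zd).
  by rewrite subrr; apply: eq_has_sum => k; rewrite mulrBl.
have r0 : 0 <= 1 / 2 :> R by lra.
have r1 : 1 / 2 < 1 :> R by lra.
have hle : cabs (a n - b n) * (1 / 2) ^+ n <= 0.
  by apply: (cauchy_estimate n h0 r0 r1) => z _; rewrite cabs0.
apply/eqP; rewrite -subr_eq0 -cabs_eq0 eq_le cabs_ge0 andbT.
by move: hle; rewrite pmulr_lle0// exprn_gt0//; lra.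
Qed.

Lemma taylor_coefE a f : disk_expansion a f -> taylor_coef f = a.
Proof.
move=> h; apply: (disk_expansion_unique (f := f)) => //.
have := @xgetPex _ (fun=> 0) [set a | disk_expansion a f].
by apply; exists a.
Qed.

End Cauchy.

(** * Re-expansion at another point of the disk *)

Section Reexpansion.
Local Open Scope complex_scope.
Context {R : realType}.
Local Notation C := (R[i]).
Implicit Types (a : nat -> C) (f : C -> C).

(** Truncating the binomial expansion of (x + y)^n at order K costs a factor
2^-K, at the price of doubling y. *)
Lemma binomial_truncation (x y : C) n K :
  cabs (\sum_(k < K) ('C(n, k))%:R * x ^+ (n - k) * y ^+ k - (x + y) ^+ n) <=
  2 ^- K * (cabs x + 2 * cabs y) ^+ n.
Proof.
have full (S : comPzRingType) (s t : S) : (s + t) ^+ n =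
    \sum_(k < K) ('C(n, k))%:R * s ^+ (n - k) * t ^+ k +
    \sum_(i < n.+1) ('C(n, K + i))%:R * s ^+ (n - (K + i)) * t ^+ (K + i).
  transitivity (\sum_(k < K + n.+1) ('C(n, k))%:R * s ^+ (n - k) * t ^+ k);
    last by rewrite big_split_ord.
  rewrite addnC big_split_ord /= [X in _ = _ + X]big1 ?addr0 => [|i _].
    by rewrite exprDn; apply: eq_bigr => i _; rewrite -mulr_natl mulrA.
  by rewrite bin_small ?mul0r// ltn_addr.
rewrite full opprD addrA subrr add0r cabsN.
apply: le_trans (cabs_sum _ _ _) _; rewrite full mulrDr.
rewrite -[leLHS]add0r lerD//.
  rewrite mulr_ge0 ?invr_ge0 ?exprn_ge0// sumr_ge0// => i _.
  by rewrite !mulr_ge0 ?exprn_ge0 ?mulr_ge0 ?cabs_ge0.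
rewrite mulr_sumr; apply: ler_sum => i _.
rewrite !cabsM !cabsX cabs_nat exprMn.
set A := _%:R * _; set Y := cabs y ^+ _; set T := 2 ^+ (K + i).
rewrite (_ : 2 ^- K * (A * (T * Y)) = (2 ^- K * T) * (A * Y)); last by ring.
rewrite /T exprD mulKf ?expf_neq0// ler_peMl ?exprn_ege1 ?ler1n//.
by rewrite !mulr_ge0 ?exprn_ge0 ?cabs_ge0.
Qed.

(** The binomial expansions truncated at order K are exponentially close to the
function near the new centre; no double series has to be rearranged. *)
Lemma disk_expansion_analytic a f : disk_expansion a f -> analytic_on_disk f.
Proof.
move=> h z0 z0d; have ha := disk_expansion_subgeometric h.
have c0 := cabs_ge0 z0.
(* The truncation bound doubles w, so that |z0| + 2 r < 1 is required. *)
pose r := (1 - cabs z0) / 4.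
have r0 : 0 < r by rewrite /r divr_gt0// subr_gt0.
have s0 : 0 <= cabs z0 + 2 * r by rewrite addr_ge0// mulr_ge0// ltW.
have s1 : cabs z0 + 2 * r < 1 by move: z0d; rewrite /r diskE; lra.
have [K [th [K0 th0 th1 hK]]] := subgeometric_le ha s0 s1.
have hb k : exists l,
    has_sum (fun n => a n * (('C(n, k))%:R * z0 ^+ (n - k))) l.
  have [|n|l hl _] := @has_sum_geo R
    (fun n => a n * (('C(n, k))%:R * z0 ^+ (n - k))) (K / r ^+ k) th th0 th1.
  - by rewrite divr_ge0// exprn_ge0// ltW.
  - rewrite mulrAC ler_pdivlMr ?exprn_gt0// cabsM cabsM cabsX cabs_nat -mulrA.
    apply: le_trans (hK n); rewrite ler_wpM2l ?cabs_ge0//.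
    have rr : 0 <= 2 * r - r by lra.
    have r0' := ltW r0.
    apply: (@le_trans _ _ ((cabs z0 + r) ^+ n)); last first.
      rewrite lerXn2r ?nnegrE ?addr_ge0//; lra.
    rewrite exprDn; have [kn|nk] := leqP k n; last first.
      by rewrite bin_small// !mul0r sumr_ge0// => i _;
         rewrite mulrn_wge0// mulr_ge0 ?exprn_ge0.
    rewrite (bigD1 (Ordinal (kn : (k < n.+1)%N))) //= -[X in _ <= X + _]mulr_natl mulrA lerDl.
    by rewrite sumr_ge0// => i _; rewrite mulrn_wge0// mulr_ge0 ?exprn_ge0.
  - by exists l.
have [b hbb] := choice hb.
exists b, r; split=> // z zr.
set w := z - z0; have zE : z = z0 + w by rewrite /w addrC subrK.
have w0 := cabs_ge0 w.
have zd : disk z.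
  rewrite diskE zE; apply: le_lt_trans (cabsD _ _) _.
  by move: zr s1; rewrite -/w; lra.
apply/has_sumP => e e0.
have h2 : 2^-1 < 1 :> R by rewrite invf_lt1// ltr1n.
have [N hN] := @geo_small R 2^-1 (K / (1 - th)) e ltac:(by rewrite invr_ge0) h2 e0.
exists N => M NM; apply: le_lt_trans (hN _ NM).
have hs := has_sumB
  (has_sum_big (fun k : 'I_M => has_sumZ (c := w ^+ k) (hbb k))) (h _ zd).
rewrite (eq_bigr (fun k : 'I_M => w ^+ k * b k)); last by move=> k _; rewrite mulrC.
apply: (has_sum_norm_le hs) => L.
apply: (@le_trans _ _ (\sum_(n < L) K * 2 ^- M * th ^+ n)).
  apply: ler_sum => n _.
  rewrite (_ : _ - _ = a n * (\sum_(k < M) ('C(n, k))%:R * z0 ^+ (n - k) * w ^+ k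
      - (z0 + w) ^+ n)); last first.
    rewrite mulrBr zE mulr_sumr; congr (_ - _); apply: eq_bigr => k _.
    by rewrite mulrC !mulrA.
  rewrite cabsM; apply: le_trans (ler_wpM2l (cabs_ge0 _) (binomial_truncation _ _ _ _)) _.
  rewrite mulrCA [K * _]mulrC -mulrA ler_wpM2l ?invr_ge0 ?exprn_ge0//.
  apply: le_trans (hK n); rewrite ler_wpM2l ?cabs_ge0//.
  apply: lerXn2r; rewrite ?nnegrE //; first by rewrite addr_ge0// mulr_ge0.
  by rewrite lerD2l ler_wpM2l// ltW.
rewrite -mulr_sumr exprVn [leRHS]mulrAC.
by rewrite ler_wpM2l ?geo_sum_le// mulr_ge0// invr_ge0 exprn_ge0.
Qed.

End Reexpansion.

(** * Measurability of power series *)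

Section Measurability.
Local Open Scope complex_scope.
Context {R : realType}.
Local Notation C := (R[i]).

Lemma measurable_lt_set d (T : measurableType d) (f g : T -> R) :
  measurable_fun setT f -> measurable_fun setT g ->
  measurable [set x | f x < g x].
Proof.
move=> mf mg.
have := measurable_fun_ltr mf mg measurableT (Y := [set true]) I.
by rewrite setTI; congr measurable; apply/seteqP; split.
Qed.

Lemma measurable_le_set d (T : measurableType d) (f g : T -> R) :
  measurable_fun setT f -> measurable_fun setT g ->
  measurable [set x | f x <= g x].
Proof.
move=> mf mg.
have := measurable_fun_ler mf mg measurableT (Y := [set true]) I.
by rewrite setTI; congr measurable; apply/seteqP; split.
Qed.

Lemma Re_R2C (w : R * R) : complex.Re (R2C w) = w.1. Proof. by []. Qed.
Lemma Im_R2C (w : R * R) : complex.Im (R2C w) = w.2. Proof. by []. Qed.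

Lemma measurable_horner (P : {poly C}) (D : set (R * R)) :
  measurable_fun D (fun w => complex.Re P.[R2C w]) /\
  measurable_fun D (fun w => complex.Im P.[R2C w]).
Proof.
suff [hR hI] : measurable_fun setT (fun w => complex.Re P.[R2C w]) /\
    measurable_fun setT (fun w => complex.Im P.[R2C w]).
  by split; apply: measurable_funTS.
elim/poly_ind: P => [|P c [hR hI]].
  by split; apply: eq_measurable_fun (measurable_cst (0 : R)) => w _ /=;
    rewrite horner0.
split.
  apply: (@eq_measurable_fun _ _ _ _ _ (fun w : R * R => complex.Re P.[R2C w] * w.1 -
      complex.Im P.[R2C w] * w.2 + complex.Re c)) => [w _|].
    by rewrite hornerMXaddC ReD; case: (P.[_]); case: w.
  apply: measurable_funD => //; apply: measurable_funB;
    apply: measurable_funM => //.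
apply: (@eq_measurable_fun _ _ _ _ _ (fun w : R * R => complex.Re P.[R2C w] * w.2 +
      complex.Im P.[R2C w] * w.1 + complex.Im c)) => [w _|].
  by rewrite hornerMXaddC ImD; case: (P.[_]); case: w.
apply: measurable_funD => //; apply: measurable_funD;
  apply: measurable_funM => //.
Qed.

Lemma diskR2C : R2C @^-1` disk = [set w : R * R | w.1 ^+ 2 + w.2 ^+ 2 < 1].
Proof.
apply/seteqP; split => w /=; rewrite diskE;
  rewrite -[w.1]Re_R2C -[w.2]Im_R2C -sqr_cabs.
  by move=> h; rewrite expr_lt1// cabs_ge0.
by rewrite expr_lt1// cabs_ge0.
Qed.

Lemma measurable_disk : measurable (R2C @^-1` disk : set (R * R)).
Proof.
rewrite diskR2C; apply: measurable_lt_set; last exact: measurable_cst.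
by apply: measurable_funD; apply: measurable_funX.
Qed.

Lemma disk_expansion_measurable (a : nat -> C) f : disk_expansion a f ->
  measurable_on_disk f.
Proof.
move=> h; pose P N := \poly_(k < N) a k.
have hc w : disk (R2C w : C) -> forall e : R, 0 < e ->
    \forall N \near \oo, cabs ((P N).[R2C w] - f (R2C w)) < e.
  move=> wd e e0; have /has_sumP /(_ _ e0) [N hN] := h _ wd.
  by exists N => // n /hN; rewrite horner_poly.
split.
- apply: (measurable_fun_cvg (h := fun N w => complex.Re (P N).[R2C w])).
  + by move=> N; have [] := measurable_horner (P N) (R2C @^-1` disk).
  + move=> w wd; apply/cvgrPdist_lt => e e0.
    apply: filterS (hc w wd e e0) => N; apply: le_lt_trans.
    rewrite distrC; apply: le_trans (Re_le_cabs _).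
    by rewrite ReD; case: (f _).
- apply: (measurable_fun_cvg (h := fun N w => complex.Im (P N).[R2C w])).
  + by move=> N; have [] := measurable_horner (P N) (R2C @^-1` disk).
  + move=> w wd; apply/cvgrPdist_lt => e e0.
    apply: filterS (hc w wd e e0) => N; apply: le_lt_trans.
    rewrite distrC; apply: le_trans (Im_le_cabs _).
    by rewrite ImD; case: (f _).
Qed.


End Measurability.

(** * Layer cake estimates *)

Section LayerCake.
Local Open Scope complex_scope.
Context {R : realType} d (T : measurableType d).
Variable mu : {measure set T -> \bar R}.

(** Integrals of nonnegative functions are suprema over simple functions, so
that they are monotone without any measurability assumption. *)
Lemma le_integral_nonneg (D E : set T) (f g : T -> \bar R) :
  (forall x, D x -> 0 <= f x)%E -> (forall x, E x -> 0 <= g x)%E ->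
  (forall x, D x -> E x /\ f x <= g x)%E ->
  (\int[mu]_(x in D) f x <= \int[mu]_(x in E) g x)%E.
Proof.
move=> f0 g0 fg; rewrite !ge0_integralE//.
apply: le_ereal_sup => _ [h /= hf <-]; exists h => // x.
apply: (le_trans (hf x)); rewrite !patchE.
case: ifPn => [/set_mem /fg [Ex fgx]|_]; first by rewrite mem_set.
by case: ifPn => // /set_mem; exact: g0.
Qed.

(** The integrand is dominated by the sum over k of c k times the indicator
function of E k. *)
Lemma layer_integral_le (D : set T) (w : T -> \bar R) (E : nat -> set T)
    (c m : nat -> R) (B : R) :
  (forall k, measurable (E k)) -> (forall k, 0 <= c k) ->
  (forall k, mu (E k) <= (m k)%:E)%E ->
  (forall n, \sum_(k < n) c k * m k <= B) ->
  (forall x, D x -> 0 <= w x)%E ->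
  (forall x, D x -> exists2 k, E k x & (w x <= (c k)%:E)%E) ->
  (\int[mu]_(x in D) w x <= B%:E)%E.
Proof.
move=> mE c0 muE cmB w0 hw.
pose f k x := ((c k)%:E * (\1_(E k) x)%:E)%E : \bar R.
have f0 k x : (0 <= f k x)%E by rewrite mule_ge0// lee_fin// indicE.
apply: (@le_trans _ _ (\int[mu]_x (\sum_(k <oo) f k x))%E).
  apply: le_integral_nonneg => // [x _|x Dx]; first exact: nneseries_ge0.
  split=> //; have [k Ek wk] := hw x Dx; apply: le_trans wk _.
  apply: le_trans (nneseries_lim_ge k.+1 _) => //.
  rewrite big_mkord big_ord_recr /=.
  have -> : f k x = (c k)%:E by rewrite /f indicE mem_set// mule1.
  by rewrite leeDr// sume_ge0.
rewrite integral_nneseries//; last first.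
  by move=> k; apply/measurable_EFinP; apply: measurable_funM.
apply: lime_le.
  by apply: is_cvg_nneseries => k _ _; apply: integral_ge0.
apply: nearW => n; rewrite big_mkord.
apply: (@le_trans _ _ (\sum_(k < n) (c k * m k)%:E)%E); last first.
  by rewrite sumEFin lee_fin.
apply: lee_sum => k _.
rewrite (@ge0_integralZl _ _ _ mu setT measurableT (EFin \o \1_(E k)))//; last 3 first.
- by apply/measurable_EFinP.
- by move=> x _; rewrite lee_fin indicE.
- by rewrite lee_fin.
by rewrite integral_indic// setIT EFinM lee_wpmul2l// lee_fin.
Qed.

Lemma ler_powRN (x y a : R) : 0 <= a -> 0 < x -> x <= y ->
  y `^ (- a) <= x `^ (- a).
Proof.
move=> a0 x0 xy; have y0 := lt_le_trans x0 xy.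
rewrite !powRN lef_pV2 ?posrE ?powR_gt0//.
by rewrite ge0_ler_powR// nnegrE ltW.
Qed.

Lemma ltr_powR2 (a b : R) : a < b -> 2 `^ a < 2 `^ b :> R.
Proof.
move=> ab; rewrite /powR pnatr_eq0 /= ltr_expR ltr_pM2r// ln_gt0//.
by rewrite ltr1n.
Qed.

(** Layer cake over the dyadic shells H / 2^(k+1) < g <= H / 2^k: the k-th one
contributes (H / 2^k)^(1-a) up to a constant, a convergent geometric series. *)
Lemma integral_powRN_small (D : set T) (g : T -> R) (M H a : R) :
  0 <= a -> a < 1 -> 0 < H -> 0 <= M ->
  (forall s, measurable (D `&` [set x | 0 < g x <= s])) ->
  (forall s, 0 < s -> s <= H ->
     (mu (D `&` [set x | (0 < g x <= s)%R]) <= (M * s)%:E)%E) ->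
  (\int[mu]_(x in D `&` [set x | (0 < g x <= H)%R]) (g x `^ (- a))%:E <=
    (2 `^ a / (1 - 2 `^ a / 2) * M * H `^ (1 - a))%:E)%E.
Proof.
move=> a0 a1 H0 M0 mE muE.
pose q := 2 `^ a : R; rewrite -/q.
have q0 : 0 < q by rewrite powR_gt0.
have q1 : q / 2 < 1.
  by rewrite ltr_pdivrMr// mul1r -[ltRHS]powRr1// ltr_powR2.
have h2 k : 0 < 2 ^- k :> R by rewrite invr_gt0 exprn_gt0.
have cE k : (H * 2 ^- k) `^ (- a) = H `^ (- a) * q ^+ k.
  rewrite powRM ?ltW// -powR_invn// -powRrM mulrNN [k%:R * a]mulrC powRrM.
  by rewrite powR_mulrn ?powR_ge0.
apply: (@layer_integral_le _ _
  (fun k => D `&` [set x | 0 < g x <= H * 2 ^- k])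
  (fun k => (H * 2 ^- k.+1) `^ (- a)) (fun k => M * (H * 2 ^- k))) => //.
- by move=> k; exact: powR_ge0.
- move=> k; apply: muE; first by rewrite mulr_gt0.
  by rewrite ger_pMr// invf_le1 ?exprn_gt0// exprn_ege1// ler1n.
- move=> n.
  rewrite (eq_bigr (fun k : 'I_n => q * M * H `^ (1 - a) * (q / 2) ^+ k)).
    rewrite -mulr_sumr.
    rewrite (_ : q / _ * M * _ = q * M * H `^ (1 - a) * (1 - q / 2)^-1).
      apply: ler_wpM2l; first by rewrite !mulr_ge0 ?powR_ge0.
      by rewrite geo_sum_le// divr_ge0// powR_ge0.
    by rewrite -!mulrA; congr (_ * _); rewrite mulrCA; congr (_ * _); rewrite mulrC.
  move=> k _; rewrite cE exprS expr_div_n powRD ?powRr1 ?(ltW H0)//; last first.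
    by rewrite (gt_eqF H0) implybT.
  ring.
- by move=> x _; rewrite lee_fin powR_ge0.
move=> x [Dx /andP[gx gH]].
have [N hN] := @geo_small R 2^-1 H (g x) ltac:(by rewrite invr_ge0) ltac:(by rewrite invf_lt1// ltr1n) gx.
have hex : exists k, H * 2 ^- k.+1 < g x.
  by exists N; have := hN N.+1 (leqnSn _); rewrite exprVn.
case: (ex_minnP hex) => k hk kmin.
exists k; last by rewrite lee_fin; apply: ler_powRN => //; rewrite ?mulr_gt0 ?(ltW hk).
split => //=; rewrite gx /=.
case: k hk kmin => [|k] hk kmin; first by rewrite expr0 invr1 mulr1.
by rewrite leNgt; apply/negP => /kmin; rewrite ltnn.
Qed.

(** Layer cake over the dyadic shells dl 2^(k-1) < g <= dl 2^k; the k-th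
contribution decreases geometrically because q > 1. *)
Lemma integral_powRN_large (D : set T) (g w : T -> R) (M dl q : R) :
  1 < q -> 0 < dl -> 0 <= M ->
  (forall s, measurable (D `&` [set x | g x <= s])) ->
  (forall s, 0 < s -> (mu (D `&` [set x | (g x <= s)%R]) <= (M * s)%:E)%E) ->
  (forall x, D x -> g x <= w x /\ dl <= w x) ->
  (\int[mu]_(x in D) (w x `^ (- q))%:E <=
    (2 `^ q / (1 - 2 / 2 `^ q) * M * dl `^ (1 - q))%:E)%E.
Proof.
move=> q1 dl0 M0 mE muE hw.
pose Q := 2 `^ q : R; rewrite -/Q.
have q0 : 0 <= q by apply: ltW; apply: lt_trans q1.
have Q2 : 2 < Q by rewrite -[ltLHS]powRr1// ltr_powR2.
have Q0 : 0 < Q by apply: lt_trans Q2.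
have Q1 : 2 / Q < 1 by rewrite ltr_pdivrMr// mul1r.
have h2 k : 0 < 2 ^+ k :> R by rewrite exprn_gt0.
have cE k : (dl / 2 * 2 ^+ k) `^ (- q) = dl `^ (- q) * Q * Q ^- k.
  have i2 : 2^-1 `^ (- q) = Q by rewrite -powR_inv1// -powRrM mulN1r opprK.
  have k2 : (2 ^+ k) `^ (- q) = Q ^- k.
    by rewrite powRN -powR_mulrn// -powRrM mulrC powRrM powR_mulrn ?powR_ge0.
  by rewrite !powRM ?i2 ?k2 ?invr_ge0 ?exprn_ge0 ?mulr_ge0 ?invr_ge0 ?(ltW dl0).
apply: (@layer_integral_le _ _
  (fun k => D `&` [set x | g x <= dl * 2 ^+ k])
  (fun k => (dl / 2 * 2 ^+ k) `^ (- q)) (fun k => M * (dl * 2 ^+ k))) => //.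
- by move=> k; exact: powR_ge0.
- by move=> k; apply: muE; rewrite mulr_gt0.
- move=> n.
  rewrite (eq_bigr (fun k : 'I_n => Q * M * dl `^ (1 - q) * (2 / Q) ^+ k)).
    rewrite -mulr_sumr.
    rewrite (_ : Q / _ * M * _ = Q * M * dl `^ (1 - q) * (1 - 2 / Q)^-1).
      apply: ler_wpM2l; first by rewrite !mulr_ge0 ?powR_ge0.
      by rewrite geo_sum_le// divr_ge0// powR_ge0.
    by rewrite -!mulrA; congr (_ * _); rewrite mulrCA; congr (_ * _); rewrite mulrC.
  move=> k _; rewrite cE expr_div_n powRD ?powRr1 ?(ltW dl0)//; last first.
    by rewrite (gt_eqF dl0) implybT.
  ring.
- by move=> x _; rewrite lee_fin powR_ge0.
move=> x Dx; have [gw dw] := hw x Dx.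
have h20 : 0 <= 2^-1 :> R by rewrite invr_ge0.
have h21 : 2^-1 < 1 :> R by rewrite invf_lt1// ltr1n.
have [N hN] := geo_small `|g x| h20 h21 dl0.
have hex : exists k, g x <= dl * 2 ^+ k.
  exists N; have := hN N (leqnn _); rewrite exprVn ltr_pdivrMr//.
  by move=> /ltW; apply: le_trans; rewrite ler_norm.
case: (ex_minnP hex) => k hk kmin.
exists k => //; rewrite lee_fin ler_powRN//.
  by rewrite mulr_gt0// divr_gt0.
case: k hk kmin => [|k] hk kmin.
  by rewrite expr0 mulr1; apply: le_trans dw; rewrite ler_pdivrMr// ler_peMr ?ler1n// ltW.
apply: le_trans gw; rewrite exprS mulrA divfK// leNgt; apply/negP => /ltW /kmin.
by rewrite ltnn.
Qed.

End LayerCake.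

(** * Polar coordinates and Carleson boxes *)

Section Trigonometry.
Local Open Scope complex_scope.
Context {R : realType}.
Local Notation C := (R[i]).

Lemma derive_le1_lipschitz (f df : R -> R) :
  (forall x : R, is_derive x 1 f (df x)) -> (forall x, `|df x| <= 1) ->
  forall x y, `|f x - f y| <= `|x - y|.
Proof.
move=> fd df1 x y; wlog xy : x y / x <= y.
  by move=> h; have [/h//|/ltW /h] := leP x y; rewrite distrC [in leRHS]distrC.
have fc : {within `[x, y], continuous f}.
  apply: continuous_subspaceT => z.
  apply/differentiable_continuous/derivable1_diffP.
  by have [] := fd z.
have [c _ h] := MVT_segment xy (fun z _ => fd z) fc.
rewrite distrC h normrM [in leRHS]distrC -[leRHS]mul1r.
by rewrite ler_wpM2r.
Qed.

Lemma cos_lipschitz (x y : R) : `|cos x - cos y| <= `|x - y|.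
Proof.
apply: (derive_le1_lipschitz (@is_derive_cos R)) => z.
by rewrite normrN sin_max.
Qed.

Lemma sin_lipschitz (x y : R) : `|sin x - sin y| <= `|x - y|.
Proof. by apply: (derive_le1_lipschitz (@is_derive_sin R)) => z; exact: cos_max. Qed.

Lemma norm_atan_le (x : R) : `|atan x| <= `|x|.
Proof.
rewrite -[x in leRHS]subr0 -[atan x]subr0 -[X in _ - X]atan0.
apply: (derive_le1_lipschitz (@is_derive1_atan R)) => z.
rewrite normfV ger0_norm ?addr_ge0 ?sqr_ge0// invf_le1 ?ltr_pwDl ?sqr_ge0//.
by rewrite lerDl sqr_ge0.
Qed.

Lemma polar_form (z : C) : exists2 t : R, 0 <= t < pi *+ 2 & z = (cabs z)%:C * cis t.
Proof.
have p0 := @pi_gt0 R.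
have [->|z0] := eqVneq z 0.
  by exists 0; [rewrite lexx pmulrn_lgt0|rewrite cabs0 mul0r].
have n0 : cabs z != 0 by rewrite cabs_eq0.
have npos : 0 < cabs z by rewrite cabs_gt0.
pose x := complex.Re z / cabs z; pose y := complex.Im z / cabs z.
have xy : x ^+ 2 + y ^+ 2 = 1.
  by rewrite !expr_div_n -mulrDl -sqr_cabs divff// sqrf_eq0.
have x1 : -1 <= x <= 1.
  by rewrite -ler_norml normrM normfV (ger0_norm (ltW npos)) ler_pdivrMr// mul1r Re_le_cabs.
have zE (t : R) : cos t = x -> sin t = y -> z = (cabs z)%:C * cis t.
  move=> ct st; rewrite /cis ct st /x /y; apply/eqP; rewrite eq_complex /=.
  by rewrite !mul0r subr0 addr0 ![cabs _ * _]mulrC !divfK// !eqxx.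
have sx : sin (acos x) = `|y|.
  by rewrite sin_acos// -xy addrC addKr sqrtr_sqr.
have cx : cos (acos x) = x by rewrite acosK// in_itv.
have [y0|y0] := leP 0 y.
  exists (acos x); last by apply: zE; rewrite // sx ger0_norm.
  rewrite acos_ge0//=; apply: le_lt_trans (acos_lepi x1) _.
  by rewrite mulr2n ltrDl.
exists (pi *+ 2 - acos x); last first.
  apply: zE; first by rewrite addrC cosD2pi cosN.
  by rewrite addrC sinD2pi sinN sx ltr0_norm// opprK.
rewrite subr_ge0 ltrBlDr ltrDl.
have acn0 : acos x != 0.
  apply/eqP => a0; move: sx; rewrite a0 sin0 => /esym /eqP.
  by rewrite normr_eq0 lt_eqF.
apply/andP; split; last by rewrite lt_neqAle eq_sym acn0 acos_ge0.
by apply: le_trans (acos_lepi x1) _; rewrite mulr2n lerDl ltW.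
Qed.

(** The argument is atan (Im z / Re z), and |atan x| <= |x|. *)
Lemma polar_form_right (z : C) : 0 < complex.Re z ->
  exists2 t : R, `|t| <= `|complex.Im z| / complex.Re z & z = (cabs z)%:C * cis t.
Proof.
case: z => x y x0; change (is_true (0 < x)) in x0; exists (atan (y / x)).
  rewrite /=; by apply: le_trans (norm_atan_le _) _; rewrite normrM normfV [`|x|]gtr0_norm.
have sE : sin (atan (y / x)) = y / x * cos (atan (y / x)).
  have c0 : cos (atan (y / x)) != 0 by rewrite gt_eqF// cos_gt0_pihalf// atan_gtNpi2 atan_ltpi2.
  by rewrite -{2}(atanK (y / x)) /tan divfK.
have cE : cabs (x +i* y) * cos (atan (y / x)) = x.
  rewrite cos_atan /cabs /=.
  have -> : x ^+ 2 + y ^+ 2 = x ^+ 2 * (1 + (y / x) ^+ 2).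
    by rewrite mulrDr mulr1 -exprMn mulrC divfK ?gt_eqF.
  rewrite sqrtrM ?sqr_ge0// sqrtr_sqr (gtr0_norm x0) mulfK//.
  by rewrite sqrtr_eq0 -ltNge ltr_pwDl// sqr_ge0.
move: cE; move: (cabs _) => r cE.
rewrite /cis sE; apply/eqP; rewrite eq_complex /= !mul0r subr0 addr0. rewrite cE eqxx /=.
by rewrite mulrCA cE divfK ?(gt_eqF x0)// eqxx.
Qed.

(** All that is retained of the polar description of a box: its points are
close to the radial projection of u and to the circle. *)
Lemma Sbox_sub (u : C) : disk u -> exists x0 y0 : R, forall z, Sbox u z ->
  [/\ disk z, `|complex.Re z - x0| <= 2 * (1 - cabs u),
      `|complex.Im z - y0| <= 2 * (1 - cabs u) &
      1 - cabs z ^+ 2 <= 2 * (1 - cabs u)].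
Proof.
rewrite diskE => u1; rewrite /Sbox; have [->|u0] := eqVneq u 0.
  exists 0, 0 => z zd; rewrite cabs0 !subr0 mulr1; split=> //.
  - by apply: le_trans (Re_le_cabs _) _; apply: ltW; apply: (lt_trans zd); lra.
  - by apply: le_trans (Im_le_cabs _) _; apply: ltW; apply: (lt_trans zd); lra.
  - by have := sqr_ge0 (cabs z); lra.
have [th _ uE] := polar_form u.
have c0 := cabs_ge0 u.
have /negbTE un0 : cabs u != 0 by rewrite cabs_eq0.
exists (cos th), (sin th) => z [th' [la [t [uE' tth h1 l1 ->]]]].
have [cth sth] : cos th' = cos th /\ sin th' = sin th.
  have : cis th' = cis th :> C.
    have un : (cabs u)%:C != 0 :> C by rewrite eq_complex /= un0.
    by apply: (mulfI un); rewrite -uE -uE'.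
  by case.
have la0 : 0 <= la by lra.
have zn : cabs (la%:C * cis t) = la by rewrite cabsM cabs_cis mulr1 cabs_real ger0_norm.
have aux (a b : R) : `|a| <= 1 -> `|a - b| <= `|t - th'| ->
    `|la * a - b| <= 2 * (1 - cabs u).
  move=> a1 ab; rewrite (_ : la * a - b = (a - b) - (1 - la) * a); last by ring.
  apply: le_trans (ler_normB _ _) _; rewrite normrM (@ger0_norm _ (1 - la)); last by lra.
  have : (1 - la) * `|a| <= 1 - la by rewrite ler_piMr//; lra.
  move: ab tth h1; lra.
split.
- by rewrite diskE zn.
- rewrite /= mul0r subr0 -cth; apply: aux; [exact: cos_max|exact: cos_lipschitz].
- rewrite /= mul0r addr0 -sth; apply: aux; [exact: sin_max|exact: sin_lipschitz].
- rewrite zn; nra.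
Qed.

End Trigonometry.

(** * The Carleson box estimate *)

Section BoxMajorant.
Local Open Scope complex_scope.
Context {R : realType}.
Local Notation C := (R[i]).
Local Notation leb := (@lebesgue_measure R).
Implicit Types e H y : R.

Lemma lebesgue_itvcc (a b : R) : (leb `[a, b]%classic <= (Num.max 0 (b - a))%:E)%E.
Proof.
rewrite lebesgue_measure_itv /= lte_fin; case: ifPn => _.
  by rewrite EFinN -EFinD lee_fin le_max lexx orbT.
by rewrite lee_fin le_max lexx.
Qed.

(** Away from the top and the bottom of the disk, the circle crosses horizontal
lines at an angle bounded below: the slice of a thin annulus is covered by two
intervals [-a, -b] and [b, a], with a^2 = 1 - y^2 and a^2 - b^2 <= s. *)
Lemma slice_measure_le (y s : R) : y ^+ 2 <= 1 / 2 -> 0 < s ->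
  (leb [set x | (0 < 1 - x ^+ 2 - y ^+ 2 <= s)%R] <= (4 * s)%:E)%E.
Proof.
move=> y2 s0; pose A := 1 - y ^+ 2.
have A2 : 1 / 2 <= A by rewrite /A; lra.
have A0 : 0 <= A by lra.
pose a := Num.sqrt A; pose b := Num.sqrt (A - s).
have a2 : a ^+ 2 = A by rewrite sqr_sqrtr.
have a0 : 0 <= a by rewrite sqrtr_ge0.
have b0 : 0 <= b by rewrite sqrtr_ge0.
have ah : 1 / 2 <= a.
  by rewrite -(ler_pXn2r (n:=2)) ?nnegrE// a2; lra.
have b2 : A - s <= b ^+ 2.
  have [As|As] := leP 0 (A - s); first by rewrite sqr_sqrtr.
  by apply: (le_trans (ltW As)); rewrite sqr_ge0.
have ab : a - b <= 2 * s.
  rewrite -(ler_pM2r (_ : 0 < a + b)); last by lra.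
  rewrite -subr_sqr a2; nra.
apply: (@le_trans _ _ (leb (`[(- a), (- b)]%classic `|` `[b, a]%classic))).
  apply: le_measure; rewrite ?inE.
  - rewrite (_ : [set x | _] = [set x : R | 0 < 1 - x ^+ 2 - y ^+ 2] `&`
       [set x : R | 1 - x ^+ 2 - y ^+ 2 <= s]); last first.
      by apply/seteqP; split => x /= /andP.
    have mf : measurable_fun setT (fun x : R => 1 - x ^+ 2 - y ^+ 2).
      by apply: measurable_funB => //; apply: measurable_funB => //; apply: measurable_funX.
    by apply: measurableI; [apply: measurable_lt_set|apply: measurable_le_set].
  - exact: measurableU.
  - move=> x /= /andP[x1 x2].
    have xa : `|x| <= a.
      rewrite -(ler_pXn2r (n:=2)) ?nnegrE// a2 real_normK ?num_real// /A; lra.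
    have xb : b <= `|x|.
      have [As|As] := leP 0 (A - s); last by rewrite /b ler0_sqrtr ?normr_ge0// ltW.
      rewrite -(ler_pXn2r (n:=2)) ?nnegrE// sqr_sqrtr// real_normK ?num_real// /A; lra.
    rewrite !in_itv /=; have [x0|x0] := leP 0 x.
      by right; move: xa xb; rewrite ger0_norm// => -> ->.
    left; move: xa xb; rewrite ltr0_norm// lerNl => ->.
    by rewrite lerNr => ->.
apply: le_trans (measureU2 _ _ _) _ => //.
have h1 := lebesgue_itvcc b a; have h2 := lebesgue_itvcc (- a) (- b).
apply: le_trans (leeD h2 h1) _; rewrite -EFinD lee_fin opprK [- b + a]addrC.
have : Num.max 0 (a - b) <= 2 * s by rewrite ge_max ab andbT mulr_ge0// ltW.
lra.
Qed.

(** The part of (1 - |z|^2)^(e-1) |y|^(-e) that lies over a box of size [H] and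
height about [y0], in the sectors where horizontal slices are short. The value
+oo on the axis y = 0, a null set, dominates any function there. *)
Definition box_majorant (e H y0 : R) (w : R * R) : \bar R :=
  if [&& `|w.2 - y0| <= H, w.2 ^+ 2 <= 1 / 2,
         0 < 1 - w.1 ^+ 2 - w.2 ^+ 2 & 1 - w.1 ^+ 2 - w.2 ^+ 2 <= H]
  then if w.2 == 0 then +oo%E
       else ((1 - w.1 ^+ 2 - w.2 ^+ 2) `^ (- (1 - e)) * `|w.2| `^ (- e))%:E
  else 0%E.

Lemma box_majorant_ge0 e H y0 w : (0 <= box_majorant e H y0 w)%E.
Proof.
rewrite /box_majorant; do 2 case: ifP => // _.
by rewrite lee_fin mulr_ge0// powR_ge0.
Qed.

Lemma measurable_box_majorant e H y0 :
  measurable_fun setT (box_majorant e H y0).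
Proof.
have m1 : measurable_fun setT (fst : R * R -> R) by exact: measurable_fst.
have m2 : measurable_fun setT (snd : R * R -> R) by exact: measurable_snd.
have m3 : measurable_fun setT (fun w : R * R => 1 - w.1 ^+ 2 - w.2 ^+ 2).
  apply: measurable_funB; last exact: measurable_funX.
  by apply: measurable_funB => //; apply: measurable_funX.
apply: measurable_fun_ifT => //.
  apply: measurable_and.
    apply: measurable_fun_ler => //; apply: measurableT_comp => //.
    exact: measurable_funB.
  apply: measurable_and; first by apply: measurable_fun_ler => //; apply: measurable_funX.
  by apply: measurable_and; [apply: measurable_fun_ltr|apply: measurable_fun_ler].
apply: measurable_fun_ifT => //.
  exact: measurable_fun_eqr.
apply/measurable_EFinP; apply: measurable_funM.
  exact: measurableT_comp (measurable_powR _) m3.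
apply: measurableT_comp (measurable_powR _) _.
exact: measurableT_comp.
Qed.


Let layer_const (a : R) : R := 2 `^ a / (1 - 2 `^ a / 2).

Let layer_const_ge0 a : a < 1 -> 0 <= layer_const a.
Proof.
move=> a1; rewrite /layer_const divr_ge0 ?powR_ge0// subr_ge0 ler_pdivrMr// mul1r.
by rewrite ltW// -[ltRHS]powRr1// ltr_powR2.
Qed.

Lemma measurable_norm_powR (a : R) (D : set R) :
  measurable_fun D (fun y : R => (`|y| `^ a)%:E).
Proof.
apply: measurable_funTS; apply/measurable_EFinP.
exact: measurableT_comp (measurable_powR _) _.
Qed.

(** For fixed y the integrand is a power of 1 - y^2 - x^2, whose sublevel sets
are controlled by [slice_measure_le]. *)
Lemma inner_integral_le e H y0 y : 0 < e -> e < 1 -> 0 < H -> y != 0 ->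
  (\int[leb]_x box_majorant e H y0 (x, y) <=
   if (`|y - y0| <= H)%R then
     (layer_const (1 - e) * 4 * H `^ e * `|y| `^ (- e))%:E else 0)%E.
Proof.
move=> e0 e1 H0 yn0.
have a1 : 1 - e < 1 by lra.
have [yy0|yy0] := boolP (`|y - y0| <= H); last first.
  rewrite (eq_integral (cst 0%E)) ?integral0// => x _.
  by rewrite /box_majorant /= (negbTE yy0).
have K0 := layer_const_ge0 a1.
have [y2|y2] := boolP (y ^+ 2 <= 1 / 2); last first.
  rewrite (eq_integral (cst 0%E)) ?integral0//.
    move: (layer_const _) K0 => K K0.
    by rewrite lee_fin !mulr_ge0 ?powR_ge0.
  by move=> x _; rewrite /box_majorant /= (negbTE y2) andbF.
pose g (x : R) := 1 - x ^+ 2 - y ^+ 2.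
have mg : measurable_fun setT g.
  by apply: measurable_funB => //; apply: measurable_funB => //; apply: measurable_funX.
have mE (s : R) : measurable (setT `&` [set x : R | 0 < g x <= s]).
  rewrite setTI (_ : [set x | _] = [set x : R | 0 < g x] `&` [set x : R | g x <= s]).
    by apply: measurableI; [apply: measurable_lt_set|apply: measurable_le_set].
  by apply/seteqP; split => x /= /andP.
have hs (s : R) : 0 < s -> s <= H ->
    (leb (setT `&` [set x : R | (0 < g x <= s)%R]) <= (4 * s)%:E)%E.
  by move=> s0 _; rewrite setTI; exact: slice_measure_le.
have e1' : 0 <= 1 - e by lra.
have h4 : 0 <= 4 :> R by [].
have hi := @integral_powRN_small R _ _ leb setT g 4 H (1 - e) e1' a1 H0 h4 mE hs.
apply: (@le_trans _ _ (\int[leb]_(x in setT `&` [set x : R | (0 < g x <= H)%R])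
  ((`|y| `^ (- e))%:E * (g x `^ (- (1 - e)))%:E))%E).
  rewrite [leRHS]integral_mkcond; apply: le_integral_nonneg => [x _|x _|x _].
  - exact: box_majorant_ge0.
  - by apply: erestrict_ge0 => z _; rewrite -EFinM lee_fin mulr_ge0 ?powR_ge0.
  split=> //; rewrite /box_majorant /= yy0 y2 /= (negbTE yn0) patchE.
  case: ifPn => [gx|ngx]; last first.
    by case: ifP => // _; rewrite -EFinM lee_fin mulr_ge0 ?powR_ge0.
  by rewrite mem_set// -EFinM lee_fin mulrC.
rewrite ge0_integralZl//; last 3 first.
- exact: mE.
- apply: measurable_funTS; apply/measurable_EFinP.
  exact: measurableT_comp (measurable_powR _) mg.
- by move=> *; rewrite lee_fin powR_ge0.
apply: (@le_trans _ _ ((`|y| `^ (- e))%:E *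
  (2 `^ (1 - e) / (1 - 2 `^ (1 - e) / 2) * 4 * H `^ (1 - (1 - e)))%:E)%E).
  by rewrite lee_wpmul2l// lee_fin powR_ge0.
by rewrite -EFinM lee_fin subKr mulrC.
Qed.

Lemma outer_integral_le e H y0 : 0 < e -> e < 1 -> 0 < H ->
  (\int[leb]_(y in [set y : R | (y != 0 /\ `|y - y0| <= H)%R]) (`|y| `^ (- e))%:E
    <= ((layer_const e * 2 + 2) * H `^ (1 - e))%:E)%E.
Proof.
move=> e0 e1 H0.
have mn : measurable_fun setT (fun y : R => `|y|) by [].
have mA (s : R) : measurable (setT `&` [set y : R | 0 < `|y| <= s]).
  rewrite setTI (_ : [set x | _] = [set x : R | 0 < `|x|] `&` [set x : R | `|x| <= s]).
    by apply: measurableI; [apply: measurable_lt_set|apply: measurable_le_set].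
  by apply/seteqP; split => x /= /andP.
have hs (s : R) : 0 < s -> s <= H ->
    (leb (setT `&` [set x : R | (0 < `|x| <= s)%R]) <= (2 * s)%:E)%E.
  move=> s0 _; apply: (@le_trans _ _ (leb `[(- s), s]%classic)).
    apply: le_measure; [by rewrite inE; apply: mA|by rewrite inE|].
    move=> x [_ /= /andP[_]]; by rewrite in_itv /= ler_norml.
  apply: le_trans (lebesgue_itvcc _ _) _; rewrite lee_fin opprK ge_max.
  by apply/andP; split; lra.
have h2 : 0 <= 2 :> R by [].
have hA := @integral_powRN_small R _ _ leb setT (fun y => `|y|) 2 H e (ltW e0) e1 H0 h2 mA hs.
(* On the part B of the interval at distance more than H from 0 the integrand
   is at most H^(-e). *)
pose A := setT `&` [set y : R | 0 < `|y| <= H].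
pose B := [set y : R | `|y - y0| <= H] `&` [set y : R | H < `|y|].
have mB : measurable B.
  apply: measurableI; [apply: measurable_le_set|apply: measurable_lt_set] => //.
  by apply: measurableT_comp => //; exact: measurable_funB.
apply: (@le_trans _ _ (\int[leb]_(y in A `|` B) (`|y| `^ (- e))%:E)%E).
  apply: le_integral_nonneg => [x _|x _|x /= [x0 xH]]; rewrite ?lee_fin ?powR_ge0//.
  split=> //; have [xs|xs] := leP `|x| H; [left|by right].
  by split => //=; rewrite normr_gt0 x0.
rewrite ge0_integral_setU; [|exact: mA|exact: mB|exact: measurable_norm_powR
  |by move=> x _; rewrite lee_fin powR_ge0|]; last first.
  rewrite disj_set2E; apply/eqP/seteqP; split => // x [[_ /= /andP[_ xH]] [_ /=]].
  by rewrite ltNge xH.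
rewrite mulrDl EFinD; apply: leeD => //.
apply: (@le_trans _ _ (\int[leb]_(y in B) (cst (H `^ (- e))%:E) y)%E).
  apply: le_integral_nonneg => [x _|x _|x Bx]; rewrite ?lee_fin ?powR_ge0//.
  by split=> //=; rewrite ?lee_fin ler_powRN ?(ltW e0)//; case: Bx => _ /= /ltW.
rewrite integral_cst//.
apply: (@le_trans _ _ ((H `^ (- e))%:E * (2 * H)%:E)%E).
  rewrite lee_wpmul2l ?lee_fin ?powR_ge0//.
  apply: (@le_trans _ _ (leb `[(y0 - H), (y0 + H)]%classic)).
    apply: le_measure; [by rewrite inE|by rewrite inE|].
    move=> x [/= xH _]; by rewrite in_itv /= -ler_distl.
  apply: le_trans (lebesgue_itvcc _ _) _; rewrite lee_fin ge_max.
  apply/andP; split; first by rewrite mulr_ge0// ltW.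
  lra.
rewrite -EFinM lee_fin powRD ?powRr1 ?(ltW H0)//; last by rewrite (gt_eqF H0) implybT.
by rewrite le_eqVlt; apply/orP; left; apply/eqP; ring.
Qed.

Lemma box_majorant_integral e : 0 < e -> e < 1 ->
  exists2 K, 0 < K & forall H y0, 0 < H ->
    (\int[leb]_y \int[leb]_x box_majorant e H y0 (x, y) <= (K * H)%:E)%E.
Proof.
move=> e0 e1; pose K1 := layer_const (1 - e) * 4; pose K2 := layer_const e * 2 + 2.
have K10 : 0 <= K1 by apply: mulr_ge0 => //; apply: layer_const_ge0; lra.
have K20 : 0 <= K2 by apply: addr_ge0 => //; apply: mulr_ge0 => //; apply: layer_const_ge0.
have hin H y0 y := @inner_integral_le e H y0 y e0 e1.
have hout H y0 := @outer_integral_le e H y0 e0 e1.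
rewrite -/K1 in hin; rewrite -/K2 in hout.
move: K1 K2 K10 K20 hin hout => K1 K2 K10 K20 hin hout.
exists (K1 * K2 + 1) => [|H y0 H0]; first by rewrite ltr_wpDl// mulr_ge0.
pose I y := (\int[leb]_x box_majorant e H y0 (x, y))%E.
have mI : measurable_fun setT I.
  exact: (measurable_fun_fubini_tonelli_G (m1 := leb) _
    (measurable_box_majorant e H y0) (box_majorant_ge0 e H y0)).
rewrite -(@integral_setD1 _ I 0 setT)//; last 2 first.
- exact: measurableD.
- exact: measurable_funTS.
pose B := [set y : R | y != 0 /\ `|y - y0| <= H].
have mB : measurable B.
  rewrite (_ : B = [set y : R | `|y - y0| <= H] `\ 0).
    apply: measurableD => //; apply: measurable_le_set => //.
    by apply: measurableT_comp => //; exact: measurable_funB.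
  apply/seteqP; split => y /= [h1 h2]; split => //; first by apply/eqP.
  by apply/eqP.
apply: (@le_trans _ _ (\int[leb]_(y in B) ((K1 * H `^ e)%:E * (`|y| `^ (- e))%:E))%E).
  rewrite [leRHS]integral_mkcond; apply: le_integral_nonneg => [y _|y _|y [_ /= /eqP y0']].
  - by apply: integral_ge0 => x _; exact: box_majorant_ge0.
  - by apply: erestrict_ge0 => z _; rewrite -EFinM lee_fin !mulr_ge0 ?powR_ge0.
  split=> //; apply: le_trans (hin _ _ _ H0 y0') _.
  rewrite patchE; case: ifPn => [yH|yH]; first by rewrite mem_set// -EFinM.
  by case: ifP => // _; rewrite -EFinM lee_fin !mulr_ge0 ?powR_ge0.
rewrite ge0_integralZl; [|exact: mB|exact: measurable_norm_powR
  |by move=> x _; rewrite lee_fin powR_ge0|by rewrite lee_fin mulr_ge0 ?powR_ge0].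
apply: (@le_trans _ _ ((K1 * H `^ e)%:E * (K2 * H `^ (1 - e))%:E)%E).
  by rewrite lee_wpmul2l ?hout// lee_fin mulr_ge0 ?powR_ge0.
rewrite -EFinM lee_fin mulrACA -powRD; last by rewrite (gt_eqF H0) implybT.
by rewrite addrC subrK powRr1 ?(ltW H0)// mulrDl mul1r lerDl ltW.
Qed.

End BoxMajorant.

Section BoxIntegral.
Local Open Scope complex_scope.
Context {R : realType}.
Local Notation C := (R[i]).
Local Notation leb := (@lebesgue_measure R).

Lemma product_integral_sum_le (W1 W2 : R * R -> \bar R) (a b B : R) :
  measurable_fun setT W1 -> measurable_fun setT W2 ->
  (forall w, 0 <= W1 w)%E -> (forall w, 0 <= W2 w)%E -> 0 <= B ->
  (\int[(leb \x leb)%E]_w W1 w <= a%:E)%E ->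
  (\int[(leb \x leb)%E]_w W2 w <= b%:E)%E ->
  (\int[(leb \x leb)%E]_w (B%:E * (W1 w + 2%:E * W2 w)) <= (B * (a + 2 * b))%:E)%E.
Proof.
move=> m1 m2 W10 W20 B0 ha hb.
have m3 : measurable_fun setT (fun w => 2%:E * W2 w)%E by apply: emeasurable_funM.
have W30 w : (0 <= 2%:E * W2 w)%E by rewrite mule_ge0.
rewrite ge0_integralZl; [|by []|exact: emeasurable_funD
  |by move=> w _; rewrite adde_ge0|by rewrite lee_fin].
rewrite ge0_integralD; [|by []|by []|by []|by []|by []].
rewrite ge0_integralZl; [|by []|by []|by []|by rewrite lee_fin].
rewrite EFinM; apply: lee_wpmul2l; first by rewrite lee_fin.
by rewrite (EFinD a) (EFinM 2 b) leeD// lee_wpmul2l.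
Qed.

(** Where y^2 <= 1/2, with y = Im z, the bound on Phi is at most the model
majorant, whose horizontal slices are short. Elsewhere x^2 <= 1/2 and |y| is
bounded below, so that the same majorant with the coordinates exchanged serves.
Tonelli's theorem, in the order suited to each, gives O(H) for a box of size H,
and H is proportional to 1 - |u|. *)
Lemma box_integral_le (e : R) : 0 < e -> e < 1 -> exists2 K : R, 0 < K &
  forall (Phi : C -> R) (B : R), 0 <= B -> (forall z, 0 <= Phi z) ->
  (forall z, disk z -> complex.Im z != 0 ->
    Phi z <= B * ((1 - cabs z ^+ 2) `^ (- (1 - e)) *
                  `|complex.Im z| `^ (- e))) ->
  forall u, disk u ->
  ((1 - cabs u ^+ 2)^-1%:E * area_integral (Sbox u) (fun z => (Phi z)%:E)
    <= (K * B)%:E)%E.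
Proof.
move=> e0 e1; have [K K0 hK] := @box_majorant_integral R e e0 e1.
exists (6 * K) => [|Phi B B0 Phi0]; first by rewrite mulr_gt0.
(* For B = 0 the product with the value +oo of the majorant would vanish. *)
wlog B1 : B B0 / 0 < B => [hB|] hPhi u ud.
  apply/lee_addgt0Pr => t t0.
  have K6 : 0 < 6 * K by rewrite mulr_gt0.
  rewrite -EFinD (_ : 6 * K * B + t = 6 * K * (B + t / (6 * K))); last first.
    by rewrite mulrDr mulrCA divff ?mulr1// gt_eqF.
  have tK : 0 < t / (6 * K) by rewrite divr_gt0.
  apply: hB ud; [exact: addr_ge0 B0 (ltW tK)|exact: ltr_wpDl|].
  move=> z zd zi; apply: le_trans (hPhi z zd zi) _.
  by rewrite ler_wpM2r ?mulr_ge0 ?powR_ge0// lerDl ltW.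
have c0 := cabs_ge0 u.
have u1 : 0 < 1 - cabs u by rewrite subr_gt0.
have [x0 [y0 hS]] := Sbox_sub ud.
pose H := 2 * (1 - cabs u); have H0 : 0 < H by rewrite mulr_gt0.
pose W1 := box_majorant e H y0.
pose W2 w := box_majorant e H x0 (w.2, w.1).
have m1 : measurable_fun setT W1 by exact: measurable_box_majorant.
have m2 : measurable_fun setT W2.
  exact: measurableT_comp (measurable_box_majorant e H x0) (@measurable_swap _ _ _ _).
have W10 w : (0 <= W1 w)%E by exact: box_majorant_ge0.
have W20 w : (0 <= W2 w)%E by exact: box_majorant_ge0.
have I1 : (\int[(leb \x leb)%E]_w W1 w <= (K * H)%:E)%E.
  by rewrite fubini_tonelli2//; exact: hK.
have I2 : (\int[(leb \x leb)%E]_w W2 w <= (K * H)%:E)%E.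
  by rewrite fubini_tonelli1//; exact: hK.
have I3 := product_integral_sum_le m1 m2 W10 W20 B0 I1 I2.
have main : (\int[(leb \x leb)%E]_(w in R2C @^-1` Sbox u) (Phi (R2C w))%:E
    <= (B * (K * H + 2 * (K * H)))%:E)%E.
  apply: le_trans I3; apply: le_integral_nonneg => [w _|w _|w /= /hS [zd hx hy hz]].
  - by rewrite lee_fin.
  - by rewrite mule_ge0 ?lee_fin// adde_ge0// mule_ge0.
  split=> //; have := hPhi _ zd.
  move: zd hx hy hz; rewrite diskE => zd.
  have := sqr_cabs (R2C w); rewrite Re_R2C Im_R2C => cw.
  have d0 : 0 < 1 - w.1 ^+ 2 - w.2 ^+ 2.
    have w1 : cabs (R2C w) ^+ 2 < 1 by rewrite expr_lt1 ?cabs_ge0.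
    rewrite cw in w1; lra.
  have -> : 1 - cabs (R2C w) ^+ 2 = 1 - w.1 ^+ 2 - w.2 ^+ 2 by rewrite cw; ring.
  rewrite -/H => hx hy hz hP.
  set d := 1 - w.1 ^+ 2 - w.2 ^+ 2 in d0 hz hP.
  have [y2|y2] := boolP (w.2 ^+ 2 <= 1 / 2).
    apply: (@le_trans _ _ (B%:E * W1 w)%E); last first.
      by rewrite lee_wpmul2l ?lee_fin// leeDl// mule_ge0.
    rewrite /W1 /box_majorant -/d hy y2 d0 hz /=.
    have [yz|yn] := eqVneq w.2 0; first by rewrite gt0_muley ?leey ?lte_fin.
    by rewrite -EFinM lee_fin hP.
  have x2 : w.1 ^+ 2 <= 1 / 2 by move: y2; rewrite -ltNge /d in d0 *; lra.
  apply: (@le_trans _ _ (B%:E * (2%:E * W2 w))%E); last first.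
    by rewrite lee_wpmul2l ?lee_fin// leeDr.
  have dE : 1 - w.2 ^+ 2 - w.1 ^+ 2 = d by rewrite /d; ring.
  rewrite /W2 /box_majorant /= dE hx x2 d0 hz /=.
  have [xz|xn] := eqVneq w.1 0.
    by rewrite gt0_muley ?gt0_muley ?leey ?lte_fin.
  have yn : w.2 != 0.
    by apply: contraNneq y2 => ->; rewrite expr0n /=; lra.
  rewrite -!EFinM lee_fin; apply: le_trans (hP yn) _; rewrite ler_wpM2l//.
  rewrite mulrCA ler_wpM2l ?powR_ge0//.
  have yh : 1 / 2 <= `|w.2|.
    rewrite -(ler_pXn2r (n:=2)) ?nnegrE// real_normK ?num_real//.
    by move: y2; rewrite -ltNge; lra.
  have xl : `|w.1| <= 1.
    rewrite -(ler_pXn2r (n:=2)) ?nnegrE// real_normK ?num_real//; lra.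
  apply: (@le_trans _ _ 2).
    apply: le_trans (ler_powRN (ltW e0) _ yh) _; first by lra.
    rewrite mul1r -powR_inv1// -powRrM mulrN mulN1r opprK.
    by apply: le_trans (ltW (ltr_powR2 e1)) _; rewrite powRr1.
  rewrite ler_peMr//.
  have x0' : 0 < `|w.1| by rewrite normr_gt0.
  by have := ler_powRN (ltW e0) x0' xl; rewrite powR1.
rewrite /area_integral.
have p1 : 0 < pi^-1 :> R by rewrite invr_gt0 pi_gt0.
have p2 : pi^-1 <= 1 :> R.
  by rewrite invf_le1 ?pi_gt0//; apply: le_trans (pi_ge2 R); lra.
have v0 : 0 < 1 - cabs u ^+ 2 by rewrite subr_gt0 expr_lt1.
have v1 : (1 - cabs u ^+ 2)^-1 <= (1 - cabs u)^-1.
  by rewrite lef_pV2 ?posrE// lerD2l lerN2 expr2 ler_piMr// ltW.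
have iv0 : 0 <= (1 - cabs u ^+ 2)^-1 by rewrite invr_ge0 ltW.
apply: (@le_trans _ _ ((1 - cabs u ^+ 2)^-1%:E *
    (pi^-1%:E * (B * (K * H + 2 * (K * H)))%:E))%E).
  by rewrite lee_wpmul2l ?lee_fin// lee_wpmul2l ?lee_fin ?(ltW p1).
rewrite -!EFinM lee_fin.
set X := B * _; have X0 : 0 <= X by rewrite mulr_ge0// addr_ge0 ?mulr_ge0// ltW// mulr_gt0.
apply: (@le_trans _ _ ((1 - cabs u)^-1 * X)).
  apply: ler_pM => //; first by rewrite mulr_ge0// ltW.
  by rewrite ler_piMl.
rewrite /X /H ler_pdivrMl//; lra.
Qed.

End BoxIntegral.

(** * The mean value property over disks *)

Section MeanValue.
Local Open Scope complex_scope.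
Context {R : realType}.
Local Notation C := (R[i]).
Local Notation leb := (@lebesgue_measure R).
Implicit Types (Q G : {poly C}) (z v : C).

Lemma ReM z v : complex.Re (z * v) =
  complex.Re z * complex.Re v - complex.Im z * complex.Im v.
Proof. by case: z; case: v. Qed.

Lemma ImM z v : complex.Im (z * v) =
  complex.Re z * complex.Im v + complex.Im z * complex.Re v.
Proof. by case: z; case: v. Qed.

Lemma Re_line z v (t : R) :
  complex.Re (z + t%:C * v) = complex.Re z + t * complex.Re v.
Proof. by rewrite ReD Re_realM. Qed.

Lemma Im_line z v (t : R) :
  complex.Im (z + t%:C * v) = complex.Im z + t * complex.Im v.
Proof. by rewrite ImD ImM /= mul0r addr0. Qed.

Lemma is_derive_horner_line Q z v (t : R) :
  is_derive t 1 (fun t : R => complex.Re Q.[z + t%:C * v])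
    (complex.Re (v * (deriv Q).[z + t%:C * v])) /\
  is_derive t 1 (fun t : R => complex.Im Q.[z + t%:C * v])
    (complex.Im (v * (deriv Q).[z + t%:C * v])).
Proof.
elim/poly_ind: Q => [|Q c [hR hI]].
  rewrite linear0 horner0 mulr0 /=; split;
    rewrite (_ : (fun t => _) = cst 0); try exact: is_derive_cst;
    by apply/funext => s; rewrite horner0.
have hx : is_derive t 1 (fun t : R => complex.Re z + t * complex.Re v) (complex.Re v).
  by apply: is_derive_eq; rewrite add0r mul1r scaler0 add0r /GRing.scale /= mulr1.
have hy : is_derive t 1 (fun t : R => complex.Im z + t * complex.Im v) (complex.Im v).
  by apply: is_derive_eq; rewrite add0r mul1r scaler0 add0r /GRing.scale /= mulr1.
split.
  rewrite (_ : (fun t => _) = fun t : R =>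
    complex.Re Q.[z + t%:C * v] * (complex.Re z + t * complex.Re v) -
    complex.Im Q.[z + t%:C * v] * (complex.Im z + t * complex.Im v) + complex.Re c).
    apply: is_derive_eq.
    rewrite derivMXaddC hornerD hornerMX !(ReM, ImM, ReD, ImD) /= !mul0r subr0 addr0.
    rewrite /GRing.scale /=; ring.
  by apply/funext => s; rewrite hornerMXaddC ReD ReM Re_line Im_line.
rewrite (_ : (fun t => _) = fun t : R =>
    complex.Re Q.[z + t%:C * v] * (complex.Im z + t * complex.Im v) +
    complex.Im Q.[z + t%:C * v] * (complex.Re z + t * complex.Re v) + complex.Im c).
  apply: is_derive_eq.
  rewrite derivMXaddC hornerD hornerMX !(ReM, ImM, ReD, ImD) /= !mul0r subr0 addr0.
  rewrite /GRing.scale /=; ring.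
by apply/funext => s; rewrite hornerMXaddC ImD ImM Re_line Im_line.
Qed.

Lemma horner_bounded Q (B : R) : exists K, forall z, cabs z <= B -> cabs Q.[z] <= K.
Proof.
elim/poly_ind: Q => [|Q c [K hK]].
  by exists 0 => z _; rewrite horner0 cabs0.
exists (K * B + cabs c) => z zB; rewrite hornerMXaddC.
apply: le_trans (cabsD _ _) _; rewrite cabsM lerD2r.
by rewrite ler_pM ?cabs_ge0 ?hK.
Qed.

(** The fundamental theorem of calculus on a chord, at the ends of which the
primitive vanishes. *)
Lemma slice_integral0 (phi dphi : R -> R) (c t : R) :
  (forall x : R, is_derive x 1 phi (dphi x)) -> continuous dphi ->
  (forall x, (x - c) ^+ 2 = t -> phi x = 0) ->
  (\int[leb]_(x in [set x : R | ((x - c) ^+ 2 <= t)%R]) (dphi x)%:E = 0)%E.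
Proof.
move=> hd hc h0; have [t0|t0] := ltP t 0.
  rewrite (_ : [set x | _] = set0) ?integral_set0//.
  by apply/seteqP; split => // x /=; rewrite leNgt (lt_le_trans t0 (sqr_ge0 _)).
pose s := Num.sqrt t; have s0 : 0 <= s by rewrite sqrtr_ge0.
have s2 : s ^+ 2 = t by rewrite sqr_sqrtr.
have -> : [set x : R | (x - c) ^+ 2 <= t] = `[c - s, c + s]%classic.
  apply/seteqP; split => x /=; rewrite in_itv /= -ler_distl -s2.
    by rewrite -[_ ^+ 2]real_normK ?num_real// ler_pXn2r ?nnegrE.
  by move=> h; rewrite -[_ ^+ 2]real_normK ?num_real// ler_pXn2r ?nnegrE.
move: s0; rewrite le_eqVlt => /predU1P[<-|s0].
  by rewrite subr0 addr0 set_itv1 integral_set1.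
have phic : continuous phi.
  move=> x; apply/differentiable_continuous/derivable1_diffP.
  by have [] := hd x.
rewrite (continuous_FTC2 (F := phi)).
- have -> : phi (c + s) = 0 by apply: h0; rewrite [c + s]addrC addrK.
  have -> : phi (c - s) = 0 by apply: h0; rewrite [c - s]addrC addrK sqrrN.
  by rewrite subee.
- lra.
- exact: continuous_subspaceT.
- split.
  + by move=> x _; have [] := hd x.
  + by apply: cvg_at_right_filter; exact: phic.
  + by apply: cvg_at_left_filter; exact: phic.
- by move=> x _; rewrite derive1E; have [] := hd x.
Qed.

End MeanValue.

Section MeanValueDisc.
Local Open Scope complex_scope.
Context {R : realType}.
Local Notation C := (R[i]).
Local Notation leb := (@lebesgue_measure R).
Local Notation area := ((leb \x leb)%E).
Variables (x0 y0 rho : R).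
Hypothesis rho0 : 0 < rho.
Implicit Types (Q G : {poly C}) (w : R * R).

Definition cdisc : set (R * R) :=
  [set w | (w.1 - x0) ^+ 2 + (w.2 - y0) ^+ 2 <= rho ^+ 2].

Let m1 : measurable_fun setT (fst : R * R -> R). Proof. exact: measurable_fst. Qed.
Let m2 : measurable_fun setT (snd : R * R -> R). Proof. exact: measurable_snd. Qed.

Lemma measurable_cdisc : measurable cdisc.
Proof.
apply: measurable_le_set; last exact: measurable_cst.
by apply: measurable_funD; apply: measurable_funX; apply: measurable_funB.
Qed.

Let mcdisc : measurable (cdisc : set (measurableTypeR R * measurableTypeR R)).
Proof. exact: measurable_cdisc. Qed.

Lemma area_rect (a b c d : R) : a <= b -> c <= d ->
  area (`[a, b]%classic `*` `[c, d]%classic) = ((b - a) * (d - c))%:E.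
Proof.
have h (s t : R) : s <= t -> leb `[s, t]%classic = (t - s)%:E.
  rewrite lebesgue_measure_itv /= lte_fin le_eqVlt => /predU1P[->|st].
    by rewrite ltxx subrr.
  by rewrite st -EFinD.
by move=> ab cd; rewrite EFinM -(h _ _ ab) -(h _ _ cd); exact: product_measure1E.
Qed.

Lemma cdisc_norm w : cdisc w -> `|w.1 - x0| <= rho /\ `|w.2 - y0| <= rho.
Proof.
rewrite /cdisc /= => h; have r0 := ltW rho0.
have := sqr_ge0 (w.1 - x0); have := sqr_ge0 (w.2 - y0) => h1 h2.
by split; rewrite -(ler_pXn2r (n:=2)) ?nnegrE// real_normK ?num_real//; lra.
Qed.

Lemma area_cdisc : exists2 m : R, rho ^+ 2 <= m & area cdisc = m%:E.
Proof.
have r0 := ltW rho0.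
have up : (area cdisc <= ((rho + rho) * (rho + rho))%:E)%E.
  have := @area_rect (x0 - rho) (x0 + rho) (y0 - rho) (y0 + rho).
  rewrite (_ : x0 + rho - (x0 - rho) = rho + rho); last by ring.
  rewrite (_ : y0 + rho - (y0 - rho) = rho + rho); last by ring.
  move=> <-; [|lra|lra].
  apply: le_measure; rewrite ?inE; [exact: measurable_cdisc|exact: measurableX|].
  move=> w /cdisc_norm [hx hy]; split; rewrite /= in_itv /= -ler_distl //.
have lo : ((rho * rho)%:E <= area cdisc)%E.
  have := @area_rect (x0 - rho / 2) (x0 + rho / 2) (y0 - rho / 2) (y0 + rho / 2).
  rewrite (_ : x0 + rho / 2 - (x0 - rho / 2) = rho); last by field.
  rewrite (_ : y0 + rho / 2 - (y0 - rho / 2) = rho); last by field.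
  move=> <-; [|lra|lra].
  apply: le_measure; rewrite ?inE; [exact: measurableX|exact: measurable_cdisc|].
  have aux (s : R) : `|s| <= rho / 2 -> s ^+ 2 <= rho ^+ 2 / 4.
    move=> h; rewrite -[s ^+ 2]real_normK ?num_real//.
    rewrite (_ : rho ^+ 2 / 4 = (rho / 2) ^+ 2); last by field.
    by rewrite lerXn2r ?nnegrE// divr_ge0.
  move=> w [/=]; rewrite !in_itv /= -!ler_distl => /aux hx /aux hy.
  by rewrite /cdisc /=; have := sqr_ge0 rho; lra.
have fin : area cdisc \is a fin_num.
  rewrite ge0_fin_numE; first exact: le_lt_trans up (ltry _).
  exact: measure_ge0.
exists (fine (area cdisc)); last by rewrite fineK.
by rewrite -lee_fin fineK// expr2.
Qed.

Lemma integrable_cdisc (g : R * R -> R) (K : R) : measurable_fun setT g ->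
  (forall w, cdisc w -> `|g w| <= K) -> area.-integrable cdisc (EFin \o g).
Proof.
move=> mg gK; apply: measurable_bounded_integrable.
- exact: measurable_cdisc.
- by have [m _ hm] := area_cdisc; have : (area cdisc < +oo)%E by rewrite hm ltry.
- exact: measurable_funTS.
exists K; split; first exact: num_real.
by move=> M KM w wD; apply: le_trans (gK _ wD) (ltW KM).
Qed.

(* A primitive vanishing on the boundary circle, and its two partial
   derivatives. *)
Let bump w : R := rho ^+ 2 - (w.1 - x0) ^+ 2 - (w.2 - y0) ^+ 2.
Let dx Q w : R := - (2 * (w.1 - x0)) * complex.Re Q.[R2C w] +
  bump w * complex.Re (1 * (deriv Q).[R2C w]).
Let dy Q w : R := - (2 * (w.2 - y0)) * complex.Re Q.[R2C w] +
  bump w * complex.Re ('i * (deriv Q).[R2C w]).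

Let mbump : measurable_fun setT bump.
Proof.
apply: measurable_funB; last by apply: measurable_funX; apply: measurable_funB.
by apply: measurable_funB => //; apply: measurable_funX; apply: measurable_funB.
Qed.

Let mpart (v : C) (g : R * R -> R) Q : measurable_fun setT g ->
  measurable_fun setT (fun w => - (2 * g w) * complex.Re Q.[R2C w] +
  bump w * complex.Re (v * (deriv Q).[R2C w])).
Proof.
move=> mg; have [q1 _] := measurable_horner Q (setT : set (R * R)).
have [q2 _] := measurable_horner (v *: deriv Q) (setT : set (R * R)).
apply: measurable_funD.
  apply: measurable_funM => //; apply: measurable_funN.
  by apply: measurable_funM.
apply: measurable_funM => //.
by rewrite (_ : (fun w => _) = fun w => complex.Re (v *: deriv Q).[R2C w])//;
  apply/funext => w; rewrite hornerZ.
Qed.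

Let bpart (v : C) (g : R * R -> R) Q : cabs v = 1 ->
  (forall w, cdisc w -> `|g w| <= rho) ->
  exists K, forall w, cdisc w -> `|- (2 * g w) * complex.Re Q.[R2C w] +
  bump w * complex.Re (v * (deriv Q).[R2C w])| <= K.
Proof.
move=> v1 hg; pose B := `|x0| + rho + (`|y0| + rho).
have [K1 h1] := horner_bounded Q B; have [K2 h2] := horner_bounded (deriv Q) B.
have zB w : cdisc w -> cabs (R2C w) <= B.
  move=> /cdisc_norm [hx hy]; apply: le_trans (cabs_le_ReIm _) _.
  rewrite Re_R2C Im_R2C; apply: lerD.
    by rewrite -(subrK x0 w.1) addrC; apply: le_trans (ler_normD _ _) _; rewrite lerD2l.
  by rewrite -(subrK y0 w.2) addrC; apply: le_trans (ler_normD _ _) _; rewrite lerD2l.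
exists (2 * rho * K1 + rho ^+ 2 * K2) => w wD.
apply: le_trans (ler_normD _ _) _; rewrite [X in X + _ <= _]normrM [X in _ + X <= _]normrM normrN.
have r0 := ltW rho0.
apply: lerD; apply: ler_pM => //.
- by rewrite normrM ger0_norm// ler_wpM2l// hg.
- exact: le_trans (Re_le_cabs _) (h1 _ (zB _ wD)).
- rewrite /bump; have := wD; rewrite /cdisc /= => hD.
  have := sqr_ge0 (w.1 - x0); have := sqr_ge0 (w.2 - y0) => s1 s2.
  by rewrite ger0_norm; lra.
- apply: le_trans (Re_le_cabs _) _; rewrite cabsM v1 mul1r; exact: (h2 _ (zB _ wD)).
Qed.

Let idx Q : area.-integrable cdisc (fun w => (dx Q w)%:E).
Proof.
have [K hK] := bpart Q (@cabs1 R) (fun w wD => (cdisc_norm wD).1).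
by apply: integrable_cdisc hK; apply: mpart; apply: measurable_funB.
Qed.

Let idy Q : area.-integrable cdisc (fun w => (dy Q w)%:E).
Proof.
have i1 : cabs ('i : C) = 1 by rewrite /cabs /= expr0n add0r expr1n sqrtr1.
have [K hK] := bpart Q i1 (fun w wD => (cdisc_norm wD).2).
by apply: integrable_cdisc hK; apply: mpart; apply: measurable_funB.
Qed.

Let slice_deriv (v z : C) Q (a c : R) (t : R) :
  let phi := fun x : R => (a - (x - c) ^+ 2) * complex.Re Q.[z + x%:C * v] in
  let dphi := fun x : R => - (2 * (x - c)) * complex.Re Q.[z + x%:C * v] +
    (a - (x - c) ^+ 2) * complex.Re (v * (deriv Q).[z + x%:C * v]) in
  is_derive t 1 phi (dphi t) /\ {for t, continuous dphi}.
Proof.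
move=> phi dphi; have [h1 _] := is_derive_horner_line Q z v t.
have [h2 _] := is_derive_horner_line (v *: deriv Q) z v t.
split.
  apply: is_derive_eq; rewrite /dphi /GRing.scale /=; ring.
apply/differentiable_continuous/derivable1_diffP.
rewrite /dphi (_ : (fun x : R => _) = fun x : R => - (2 * (x - c)) * complex.Re Q.[z + x%:C * v] +
    (a - (x - c) ^+ 2) * complex.Re (v *: deriv Q).[z + x%:C * v]).
  by apply: ex_derive.
by apply/funext => x; rewrite hornerZ.
Qed.

Lemma integral_dx Q : (\int[area]_(w in cdisc) (dx Q w)%:E = 0)%E.
Proof.
have hi := (integrable_mkcond _ mcdisc).1 (idx Q).
rewrite integral_mkcond -(integral21_prod_meas1 hi).
rewrite (eq_integral (cst 0%E)) ?integral0// => y _.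
transitivity (\int[leb]_(x in [set x : R | ((x - x0) ^+ 2 <= rho ^+ 2 - (y - y0) ^+ 2)%R])
   (dx Q (x, y))%:E)%E.
  rewrite [RHS]integral_mkcond; apply: eq_integral => x _.
  rewrite !patchE (_ : ((x, y) \in cdisc) = (x \in [set x : R |
    (x - x0) ^+ 2 <= rho ^+ 2 - (y - y0) ^+ 2]))//.
  apply/idP/idP => /set_mem /= h; apply/mem_set; move: h; rewrite /cdisc /=; lra.
have E (x : R) : R2C (0, y) + x%:C * 1 = R2C (x, y) :> C.
  by rewrite mulr1; apply/eqP; rewrite eq_complex /= add0r addr0 !eqxx.
have h x := @slice_deriv 1 (R2C (0, y)) Q (rho ^+ 2 - (y - y0) ^+ 2) x0 x.
rewrite -[RHS](slice_integral0 (fun x => (h x).1) (fun x => (h x).2)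
  (c := x0) (t := rho ^+ 2 - (y - y0) ^+ 2)); last by move=> x ->; rewrite subrr mul0r.
apply: eq_integral => x _; congr EFin; rewrite /dx /bump !E /=; ring.
Qed.

Lemma integral_dy Q : (\int[area]_(w in cdisc) (dy Q w)%:E = 0)%E.
Proof.
have hi := (integrable_mkcond _ mcdisc).1 (idy Q).
rewrite integral_mkcond -(integral12_prod_meas1 hi).
rewrite (eq_integral (cst 0%E)) ?integral0// => x _.
transitivity (\int[leb]_(y in [set y : R | ((y - y0) ^+ 2 <= rho ^+ 2 - (x - x0) ^+ 2)%R])
   (dy Q (x, y))%:E)%E.
  rewrite [RHS]integral_mkcond; apply: eq_integral => y _.
  rewrite !patchE (_ : ((x, y) \in cdisc) = (y \in [set y : R |
    (y - y0) ^+ 2 <= rho ^+ 2 - (x - x0) ^+ 2]))//.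
  apply/idP/idP => /set_mem /= h; apply/mem_set; move: h; rewrite /cdisc /=; lra.
have E (y : R) : R2C (x, 0) + y%:C * 'i = R2C (x, y) :> C.
  by apply/eqP; rewrite eq_complex /= !(mul0r, mulr0, mulr1, subr0, addr0, add0r) !eqxx.
have h y := @slice_deriv 'i (R2C (x, 0)) Q (rho ^+ 2 - (x - x0) ^+ 2) y0 y.
rewrite -[RHS](slice_integral0 (fun x => (h x).1) (fun x => (h x).2)
  (c := y0) (t := rho ^+ 2 - (x - x0) ^+ 2)); last by move=> y ->; rewrite subrr mul0r.
apply: eq_integral => y _; congr EFin; rewrite /dy /bump !E /=; ring.
Qed.

(** Write P - P(z0) = (z - z0) G and B = rho^2 - |z - z0|^2. Then
-2 (z - z0) G is the x-derivative of B G plus i times its y-derivative, and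
both integrate to 0 along chords since B vanishes on the circle. *)
Lemma mean_value_cdisc P : (\int[area]_(w in cdisc) (complex.Re P.[R2C w])%:E =
  (complex.Re P.[R2C (x0, y0)])%:E * area cdisc)%E.
Proof.
pose z0 : C := R2C (x0, y0).
have : root (P - P.[z0]%:P) z0 by rewrite /root !hornerE subrr.
move=> /factor_theorem [G hG].
have PE w : complex.Re P.[R2C w] = complex.Re P.[z0] +
    (- 2^-1 * dx G w + - 2^-1 * dy ('i *: G) w).
  have -> : P.[R2C w] = P.[z0] + G.[R2C w] * (R2C w - z0).
    by rewrite -[P in LHS](subrK P.[z0]%:P) hG !hornerE addrC.
  rewrite ReD; congr (_ + _).
  rewrite /dx /dy derivZ !hornerZ mul1r !(ReM, ImM, ReD, ImD) /=.
  by rewrite /bump; field.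
under eq_integral do rewrite PE EFinD EFinD EFinM EFinM.
have ic : area.-integrable cdisc (fun=> (complex.Re P.[z0])%:E).
  by apply: (@integrable_cdisc (cst (complex.Re P.[z0])) `|complex.Re P.[z0]|).
have i1 := integrableZl mcdisc (- 2^-1) (idx G).
have i2 := integrableZl mcdisc (- 2^-1) (idy ('i *: G)).
rewrite integralD//; last exact: integrableD.
rewrite integralD// !integralZl//.
by rewrite integral_dx integral_dy !mule0 !adde0 integral_cst.
Qed.

End MeanValueDisc.

(** * Growth of analytic functions in the tent space *)

Section Subharmonicity.
Local Open Scope complex_scope.
Context {R : realType}.
Local Notation C := (R[i]).
Local Notation leb := (@lebesgue_measure R).
Local Notation area := ((leb \x leb)%E).
Implicit Types (a : nat -> C) (f : C -> C) (u z : C).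

Lemma measurable_cabs_powR f (p : R) (D : set (R * R)) :
  measurable_fun D (fun w => complex.Re (f (R2C w))) ->
  measurable_fun D (fun w => complex.Im (f (R2C w))) ->
  measurable_fun D (fun w => ((cabs (f (R2C w))) `^ p)%:E).
Proof.
move=> mR mI; apply/measurable_EFinP.
rewrite (_ : (fun w => _) = fun w => (complex.Re (f (R2C w)) ^+ 2 +
  complex.Im (f (R2C w)) ^+ 2) `^ (2^-1 * p)).
  apply: measurableT_comp (measurable_powR _) _.
  by apply: measurable_funD; apply: measurable_funX.
apply/funext => w; rewrite -sqr_cabs powRrM powR12_sqrt ?sqr_ge0//.
by rewrite sqrtr_sqr ger0_norm// cabs_ge0.
Qed.

Lemma cdiscE (x0 y0 rho : R) w : 0 <= rho ->
  cdisc x0 y0 rho w <-> cabs (R2C w - R2C (x0, y0)) <= rho.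
Proof.
move=> r0; rewrite -(ler_pXn2r (n:=2)) ?nnegrE ?cabs_ge0// sqr_cabs.
by case: w => x y; rewrite /cdisc /=.
Qed.

(** A substitute for Jensen's inequality: for t > l the first term alone is
large enough. Integrated with l half of the value at the centre of a disk, it
bounds that value by the p-th power mean, at the price of a factor 2. *)
Lemma young_powR (p l t : R) : 1 <= p -> 0 < l -> 0 <= t ->
  t <= l `^ (1 - p) * t `^ p + l.
Proof.
move=> p1 l0 t0; have [tl|lt] := leP t l.
  by rewrite -[leLHS]add0r lerD// mulr_ge0 ?powR_ge0.
rewrite -[leLHS]addr0 lerD// ?(ltW l0)//.
have t0' : 0 < t := lt_trans l0 lt.
have -> : t `^ p = t `^ (p - 1) * t.
  by rewrite mulrC mulr_powRB1//; apply: lt_le_trans p1.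
rewrite mulrA ler_peMl// -opprB powRN -powR_inv1 ?powR_ge0// -powRrM mulrN1 powRN.
rewrite mulrC ler_pdivlMr ?powR_gt0// mul1r ge0_ler_powR ?nnegrE ?subr_ge0 ?(ltW l0) ?(ltW lt)//.
Qed.

(** The mean value property of the partial sums, rotated so that their value at
the centre is nearly real and positive, followed by [young_powR]. *)
Lemma subharmonic_cdisc a f (p x0 y0 rho r : R) : disk_expansion a f ->
  1 <= p -> 0 < rho -> 0 <= r -> r < 1 ->
  (forall w, cdisc x0 y0 rho w -> cabs (R2C w) <= r) ->
  (((cabs (f (R2C (x0, y0))) / 2) `^ p * rho ^+ 2)%:E <=
   \int[area]_(w in cdisc x0 y0 rho) ((cabs (f (R2C w))) `^ p)%:E)%E.
Proof.
move=> hf p1 rho0 r0 r1 Dr.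
have [l lE] : exists l, l = cabs (f (R2C (x0, y0))) / 2 by eexists.
have l0 : 0 <= l by rewrite lE divr_ge0 ?cabs_ge0.
have p0 : 0 < p by apply: lt_le_trans p1.
set I := (X in (_ <= X)%E).
have I0 : (0 <= I)%E by apply: integral_ge0 => w _; rewrite lee_fin powR_ge0.
move: l0; rewrite le_eqVlt => /predU1P[l0|l0].
  by rewrite -lE -l0 powR0 ?gt_eqF// mul0r.
have [m rm hm] := area_cdisc x0 y0 rho0.
have m0 : 0 < m by apply: lt_le_trans rm; rewrite exprn_gt0.
case: (ltP I +oo%E) => [Ify|]; last by rewrite leye_eq => /eqP ->; rewrite leey.
have IE : I = (fine I)%:E by rewrite fineK// ge0_fin_numE.
pose k := fine I; rewrite -/k in IE.
have [mR mI] := disk_expansion_measurable hf.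
have Dd w : cdisc x0 y0 rho w -> (R2C @^-1` disk) w.
  by move=> /Dr wr; rewrite /= diskE (le_lt_trans wr).
have mD := measurable_cdisc x0 y0 rho.
have mfp : measurable_fun (cdisc x0 y0 rho) (fun w => ((cabs (f (R2C w))) `^ p)%:E).
  by apply: measurable_cabs_powR;
     [apply: measurable_funS mR|apply: measurable_funS mI] => //; exact: measurable_disk.
have [K [th [K0 th0 th1 htail]]] := disk_expansion_tail hf r0 r1.
have [om om1 omf] := cabs_rot (f (R2C (x0, y0))).
suff h : l * m <= l `^ (1 - p) * k.
  rewrite IE lee_fin -lE; apply: (@le_trans _ _ (l `^ p * m)).
    by rewrite ler_wpM2l ?powR_ge0.
  have lp : 0 < l `^ (p - 1) by rewrite powR_gt0.
  have := ler_wpM2l (ltW lp) h; rewrite !mulrA -powRD; last by rewrite (gt_eqF l0) implybT.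
  rewrite (_ : p - 1 + (1 - p) = 0) ?powRr0 ?mul1r; last by ring.
  apply: le_trans; rewrite le_eqVlt; apply/orP; left; apply/eqP; congr (_ * _).
  by rewrite mulrC mulr_powRB1// ltW.
(* Truncation at order N costs 2 m K th^N, which tends to 0. *)
suff h N : l * m <= l `^ (1 - p) * k + 2 * m * K * th ^+ N.
  exact: le_geo_limit th0 th1 h.
pose tau := K * th ^+ N; have tau0 : 0 <= tau by rewrite mulr_ge0 ?exprn_ge0.
pose P := om *: \poly_(n < N) a n.
have PE z : P.[z] = om * \sum_(n < N) a n * z ^+ n by rewrite hornerZ horner_poly.
have tailE z : cabs z <= r -> cabs (P.[z]) <= cabs (f z) + tau.
  move=> zr; rewrite PE cabsM om1 mul1r.
  rewrite -(subKr (f z) (\sum_(n < N) _)); apply: le_trans (cabsD _ _) _.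
  by rewrite cabsN lerD2l htail.
have cdc : cdisc x0 y0 rho (x0, y0) by rewrite /cdisc /= !subrr expr0n addr0 sqr_ge0.
have center : 2 * l - tau <= complex.Re P.[R2C (x0, y0)].
  rewrite PE (_ : \sum_(n < N) _ = f (R2C (x0, y0)) -
    (f (R2C (x0, y0)) - \sum_(n < N) a n * R2C (x0, y0) ^+ n)); last by rewrite subKr.
  rewrite mulrBr ReD omf (_ : 2 * l = cabs (f (R2C (x0, y0)))); last first.
    by rewrite lE mulrC divfK.
  set q := (X in om * (_ - X)); set e := f _ - q.
  have : `|complex.Re (- (om * e))| <= tau.
    by apply: le_trans (Re_le_cabs _) _; rewrite cabsN cabsM om1 mul1r htail// Dr.
  by rewrite ler_norml => /andP[h _]; rewrite lerD2l.
have mv := mean_value_cdisc x0 y0 rho0 P.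
have [mP _] := measurable_horner P (cdisc x0 y0 rho).
have upper : (\int[area]_(w in cdisc x0 y0 rho) (complex.Re P.[R2C w])%:E <=
    (l `^ (1 - p) * k + (l + tau) * m)%:E)%E.
  apply: le_trans (lee_abs _) _.
  apply: le_trans (le_abse_integral _ _ _) _ => //; first by apply/measurable_EFinP.
  apply: (@le_trans _ _ (\int[area]_(w in cdisc x0 y0 rho)
     ((l `^ (1 - p))%:E * ((cabs (f (R2C w))) `^ p)%:E + (l + tau)%:E))%E).
    apply: le_integral_nonneg => [w _|w _|w wD] /=; first by [].
      rewrite -EFinM -EFinD lee_fin; apply: addr_ge0.
        by rewrite mulr_ge0 ?powR_ge0.
      by apply: addr_ge0 => //; exact: ltW.
    split=> //; rewrite -EFinM -EFinD lee_fin.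
    apply: le_trans (Re_le_cabs _) _; apply: le_trans (tailE _ (Dr _ wD)) _.
    by rewrite addrA lerD2r young_powR// cabs_ge0.
  rewrite ge0_integralD; [|exact: mD| | | |]; last 4 first.
  - by move=> w _; rewrite -EFinM lee_fin mulr_ge0 ?powR_ge0.
  - exact: emeasurable_funM.
  - by move=> w _; rewrite lee_fin addr_ge0// ltW.
  - exact: measurable_cst.
  rewrite ge0_integralZl; [|exact: mD|exact: mfp| |]; last 2 first.
  - by move=> w _; rewrite lee_fin powR_ge0.
  - by rewrite lee_fin powR_ge0.
  rewrite -/I IE integral_cst; last exact: mD.
  rewrite (EFinD (l `^ (1 - p) * k)) (EFinM (l `^ (1 - p)) k); apply: leeD => //.
  rewrite (EFinM (l + tau) m) -hm; exact: lexx.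
move: upper; rewrite mv hm -EFinM lee_fin => upper.
have := ler_wpM2r (ltW m0) center; rewrite /tau in tau0 upper *; nra.
Qed.

End Subharmonicity.

Section BoundaryGrowth.
Local Open Scope complex_scope.
Context {R : realType}.
Local Notation C := (R[i]).
Local Notation leb := (@lebesgue_measure R).
Local Notation area := ((leb \x leb)%E).
Implicit Types (a : nat -> C) (f : C -> C) (u z : C).

(** The quantity whose supremum over u defines the tent space norm. *)
Definition box_average (p alpha : R) f u : \bar R :=
  ((1 - cabs u ^+ 2)^-1%:E * area_integral (Sbox u)
    (fun z => (cabs (f z) `^ p * (1 - cabs z ^+ 2) `^ (alpha + 1))%:E))%E.

(** After a rotation the centre is the positive number 1 - d; points of the disk
have modulus at least 1 - 5 d / 4 and, by [polar_form_right], argument at most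
d, whereas the box allows 1 - 2 d and d. *)
Lemma cdisc_sub_Sbox (t0 d : R) : 0 < d -> d <= 1 / 4 -> forall w,
  cdisc ((1 - d) * cos t0) ((1 - d) * sin t0) (d / 4) w ->
  Sbox ((1 - 2 * d)%:C * cis t0) (R2C w : C).
Proof.
move=> d0 d1 w; rewrite cdiscE; last by rewrite divr_ge0// ltW.
rewrite (_ : R2C (_, _) = (1 - d)%:C * cis t0 :> C); last first.
  by apply/eqP; rewrite eq_complex /= !mul0r subr0 addr0 !eqxx.
set u := (1 - 2 * d)%:C * cis t0; set z := R2C w => hz.
have uE : cabs u = 1 - 2 * d.
  by rewrite cabsM cabs_cis mulr1 cabs_real ger0_norm//; lra.
have un0 : u != 0 by rewrite -cabs_eq0 uE; apply/eqP => h; lra.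
rewrite /Sbox (negbTE un0).
pose z' := cis (- t0) * z.
have cc : cis (- t0) * cis t0 = 1 :> C by rewrite -cisD addNr cis0.
have hz' : cabs (z' - (1 - d)%:C) <= d / 4.
  rewrite (_ : z' - _ = cis (- t0) * (z - (1 - d)%:C * cis t0)).
    by rewrite cabsM cabs_cis mul1r.
  by rewrite mulrBr [cis (- t0) * (_ * _)]mulrCA cc mulr1.
have hre : 1 - d - d / 4 <= complex.Re z'.
  have := le_trans (Re_le_cabs _) hz'; rewrite ReD /= ler_norml.
  by case/andP => + _; lra.
have him : `|complex.Im z'| <= d / 4.
  by have := le_trans (Im_le_cabs _) hz'; rewrite ImD /= oppr0 addr0.
have re0 : 0 < complex.Re z' by lra.
have [t tz zt] := polar_form_right re0.
have zz' : cabs z' = cabs z by rewrite cabsM cabs_cis mul1r.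
have zup : cabs z <= 1 - d + d / 4.
  rewrite -zz' -(subrK (1 - d)%:C z'); apply: le_trans (cabsD _ _) _.
  by rewrite addrC cabs_real ger0_norm ?lerD2l//; lra.
have zlo : 1 - d - d / 4 <= cabs z.
  by rewrite -zz'; apply: le_trans hre _; apply: le_trans (ler_norm _) (Re_le_cabs _).
have t2 : `|t| <= d.
  apply: le_trans tz _; rewrite ler_pdivrMr//; apply: le_trans him _.
  have : 1 / 2 <= complex.Re z' by lra.
  nra.
exists t0, (cabs z), (t0 + t); rewrite uE; split => //.
- rewrite addrC addKr; lra.
- lra.
- lra.
rewrite cisD mulrCA -zz' -zt /z' mulrA -cisD subrr cis0 mul1r //.
Qed.

(** The exponent may have either sign, hence the minimum. *)
Lemma powR_comparable (b d v : R) : 0 < d -> 3 / 4 * d <= v -> v <= 5 / 2 * d ->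
  Num.min ((3 / 4) `^ b) ((5 / 2) `^ b) * d `^ b <= v `^ b.
Proof.
move=> d0 v1 v2; have v0 : 0 < v by apply: lt_le_trans v1; rewrite mulr_gt0.
have [b0|b0] := leP 0 b.
  apply: (@le_trans _ _ ((3 / 4) `^ b * d `^ b)).
    by rewrite ler_wpM2r ?powR_ge0// ge_min lexx.
  rewrite -powRM ?(ltW d0)//; apply: ge0_ler_powR => //; rewrite nnegrE ?(ltW v0)//.
  by rewrite mulr_ge0// ltW.
apply: (@le_trans _ _ ((5 / 2) `^ b * d `^ b)).
  by rewrite ler_wpM2r ?powR_ge0// ge_min lexx orbT.
rewrite -powRM ?(ltW d0)// -[b]opprK; apply: ler_powRN => //.
by rewrite oppr_ge0 ltW.
Qed.

(** The sub-mean value property on the disk of radius d / 4, compared with the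
box that contains it. *)
Lemma growth_boundary (p alpha rho1 : R) : 1 <= p -> 1 / 2 <= rho1 -> rho1 < 1 ->
  exists2 K : R, 0 < K & forall a f (S : R), disk_expansion a f -> 0 <= S ->
    (forall u, rho1 <= cabs u -> cabs u < 1 -> (box_average p alpha f u <= S%:E)%E) ->
    forall z, (1 + rho1) / 2 <= cabs z -> cabs z < 1 ->
      cabs (f z) `^ p <= K * S * (1 - cabs z) `^ (- (alpha + 2)).
Proof.
move=> p1 rho12 rho1_1.
pose ka : R := Num.min ((3 / 4) `^ (alpha + 1)) ((5 / 2) `^ (alpha + 1)).
have ka0 : 0 < ka by rewrite lt_min !powR_gt0.
exists (2 `^ p * 16 * 4 * pi / ka) => [|a f S hf S0 hS z z1 z2].
  by rewrite divr_gt0// !mulr_gt0 ?powR_gt0 ?pi_gt0.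
pose d := 1 - cabs z; rewrite -/d.
have d0 : 0 < d by rewrite subr_gt0.
have d1 : d <= 1 / 4 by rewrite /d; lra.
have zE : cabs z = 1 - d by rewrite /d; ring.
have [t0 _ zt0] := polar_form z.
pose x0 := (1 - d) * cos t0; pose y0 := (1 - d) * sin t0.
have zR : z = R2C (x0, y0).
  by rewrite zt0 zE; apply/eqP; rewrite eq_complex /= !mul0r subr0 addr0 !eqxx.
pose u : C := (1 - 2 * d)%:C * cis t0.
have uE : cabs u = 1 - 2 * d.
  by rewrite cabsM cabs_cis mulr1 cabs_real ger0_norm//; lra.
have hu : (box_average p alpha f u <= S%:E)%E.
  by apply: hS; rewrite uE; rewrite /d; lra.
have Dsub := @cdisc_sub_Sbox t0 d d0 d1.
have r4 : 0 < d / 4 by rewrite divr_gt0.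
have Dabs w : cdisc x0 y0 (d / 4) w ->
    1 - 5 / 4 * d <= cabs (R2C w) /\ cabs (R2C w) <= 1 - 3 / 4 * d.
  rewrite (cdiscE _ _ _ (ltW r4)) -zR => hw.
  have h1 : cabs (R2C w) <= cabs z + d / 4.
    by rewrite -{1}(subrK z (R2C w)) addrC; apply: le_trans (cabsD _ _) _; rewrite lerD2l.
  have h2 : cabs z <= cabs (R2C w) + d / 4.
    rewrite -{1}(subrK (R2C w) z) addrC; apply: le_trans (cabsD _ _) _.
    by rewrite lerD2l cabsB.
  by split; lra.
have r0 : 0 <= 1 - 3 / 4 * d by lra.
have r1 : 1 - 3 / 4 * d < 1 by lra.
have sub := subharmonic_cdisc hf p1 r4 r0 r1 (fun w wD => (Dabs w wD).2).
rewrite -zR in sub.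
have [mR mI] := disk_expansion_measurable hf.
have mfp : measurable_fun (cdisc x0 y0 (d / 4)) (fun w => ((cabs (f (R2C w))) `^ p)%:E).
  have Dd w : cdisc x0 y0 (d / 4) w -> (R2C @^-1` disk) w.
    by move=> /Dabs [_ wr]; rewrite /= diskE (le_lt_trans wr).
  by apply: measurable_cabs_powR;
     [apply: measurable_funS mR|apply: measurable_funS mI] => //; exact: measurable_disk.
pose c := ka * d `^ (alpha + 1).
have c0 : 0 < c by rewrite mulr_gt0// powR_gt0.
pose X := c * ((cabs (f z) / 2) `^ p * (d / 4) ^+ 2).
have hX : (X%:E <= \int[area]_(w in R2C @^-1` Sbox u)
    (cabs (f (R2C w)) `^ p * (1 - cabs (R2C w) ^+ 2) `^ (alpha + 1))%:E)%E.
  apply: (@le_trans _ _ (\int[area]_(w in cdisc x0 y0 (d / 4))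
     (c%:E * ((cabs (f (R2C w))) `^ p)%:E))%E).
    rewrite ge0_integralZl; [|exact: measurable_cdisc|exact: mfp| |]; last 2 first.
    - by move=> w _; rewrite lee_fin powR_ge0.
    - by rewrite lee_fin ltW.
    by rewrite /X EFinM; apply: lee_wpmul2l => //; rewrite lee_fin ltW.
  apply: le_integral_nonneg => [w _|w _|w wD].
  - by rewrite -EFinM lee_fin mulr_ge0 ?powR_ge0// ltW.
  - by rewrite lee_fin mulr_ge0 ?powR_ge0.
  split; first exact: Dsub.
  rewrite -EFinM lee_fin mulrC ler_wpM2l ?powR_ge0//.
  by have [h1 h2] := Dabs w wD; apply: powR_comparable => //; nra.
have pi0 := @pi_gt0 R.
have v0 : 0 < 1 - cabs u ^+ 2 by rewrite uE; nra.
have : ((1 - cabs u ^+ 2)^-1%:E * (pi^-1%:E * X%:E) <= S%:E)%E.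
  apply: le_trans hu; rewrite /box_average /area_integral.
  rewrite lee_wpmul2l ?lee_fin ?invr_ge0 ?(ltW v0)//.
  by rewrite lee_wpmul2l ?lee_fin ?invr_ge0 ?(ltW pi0).
rewrite -!EFinM lee_fin mulrCA ler_pdivrMl// ler_pdivrMl//.
move=> hXS.
have v4 : 1 - cabs u ^+ 2 <= 4 * d by rewrite uE; nra.
have hX2 : X <= 4 * d * (pi * S).
  apply: le_trans hXS _; rewrite mulrCA [leRHS]mulrCA.
  by apply: ler_wpM2l; [exact: ltW|rewrite ler_wpM2r].
rewrite powRN.
have dE : d `^ (alpha + 2) = d `^ (alpha + 1) * d.
  rewrite -{3}(powRr1 (ltW d0)) -powRD; last by rewrite (gt_eqF d0) implybT.
  by congr (_ `^ _); ring.
have da0 : 0 < d `^ (alpha + 1) by rewrite powR_gt0.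
rewrite ler_pdivlMr ?powR_gt0// dE.
have fE : cabs (f z) `^ p = 2 `^ p * (cabs (f z) / 2) `^ p.
  by rewrite -powRM ?divr_ge0 ?cabs_ge0// mulrC divfK.
rewrite fE.
have q0 : 0 < 2 `^ p :> R by rewrite powR_gt0.
rewrite -(ler_pM2r (mulr_gt0 ka0 d0)).
have -> : 2 `^ p * (cabs (f z) / 2) `^ p * (d `^ (alpha + 1) * d) * (ka * d) =
   2 `^ p * 16 * X by rewrite /X /c; field.
have -> : 2 `^ p * 16 * 4 * pi / ka * S * (ka * d) =
   2 `^ p * 16 * (4 * d * (pi * S)) by field; rewrite gt_eqF.
by rewrite ler_wpM2l// mulr_ge0// ltW.
Qed.

End BoundaryGrowth.

Section TentNorm.
Local Open Scope complex_scope.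
Context {R : realType}.
Local Notation C := (R[i]).
Local Notation leb := (@lebesgue_measure R).
Implicit Types (a : nat -> C) (f : C -> C) (u z : C).

(** The maximum principle up to a constant: the coefficients are controlled by
Cauchy's estimates on the circle of radius s. *)
Lemma maximum_principle_weak a f (r s B : R) : disk_expansion a f ->
  0 <= r -> r < s -> s < 1 -> (forall z, cabs z = s -> cabs (f z) <= B) ->
  forall z, cabs z <= r -> cabs (f z) <= B / (1 - r / s).
Proof.
move=> hf r0 rs s1 hB z zr.
have s0 : 0 < s by apply: le_lt_trans rs.
have rs1 : r / s < 1 by rewrite ltr_pdivrMr// mul1r.
have rs0 : 0 <= r / s by rewrite divr_ge0// ltW.
have ca n := cauchy_estimate n hf (ltW s0) s1 hB.
have B0 : 0 <= B by apply: le_trans (ca 0%N); rewrite mulr_ge0 ?cabs_ge0 ?exprn_ge0// ltW.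
have zd : disk z by rewrite diskE; apply: le_lt_trans zr (lt_trans rs s1).
apply: (has_sum_norm_le (hf _ zd)) => N.
apply: (@le_trans _ _ (\sum_(n < N) B * (r / s) ^+ n)).
  apply: ler_sum => n _; rewrite cabsM cabsX expr_div_n mulrA.
  rewrite ler_pdivlMr ?exprn_gt0// mulrAC.
  by rewrite ler_pM ?mulr_ge0 ?cabs_ge0 ?exprn_ge0 ?cabs_ge0 ?(ltW s0)// lerXn2r ?nnegrE ?cabs_ge0.
by rewrite -mulr_sumr ler_wpM2l// geo_sum_le.
Qed.

Lemma growth (p alpha rho1 : R) : 1 <= p -> - 2 < alpha -> 1 / 2 <= rho1 -> rho1 < 1 ->
  exists2 A : R, 0 < A & forall a f (S : R), disk_expansion a f -> 0 <= S ->
    (forall u, rho1 <= cabs u -> cabs u < 1 -> (box_average p alpha f u <= S%:E)%E) ->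
    forall z, disk z ->
      cabs (f z) <= A * S `^ p^-1 * (1 - cabs z) `^ (- ((alpha + 2) / p)).
Proof.
move=> p1 al rho12 rho1_1.
have p0 : 0 < p by apply: lt_le_trans p1.
have [K K0 hK] := growth_boundary alpha p1 rho12 rho1_1.
pose c := (alpha + 2) / p; rewrite -/c.
have c0 : 0 < c by rewrite divr_gt0//; lra.
pose r := (1 + rho1) / 2; pose s := (1 + r) / 2.
have r0 : 0 <= r by rewrite /r; lra.
have rs : r < s by rewrite /s /r; lra.
have s1 : s < 1 by rewrite /s /r; lra.
have rs1 : 0 < 1 - r / s.
  by rewrite subr_gt0 ltr_pdivrMr ?mul1r//; apply: le_lt_trans rs.
pose M := (1 - s) `^ (- c) / (1 - r / s).
have M0 : 0 <= M by rewrite divr_ge0 ?powR_ge0// ltW.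
pose L := K `^ p^-1; have L0 : 0 < L by rewrite powR_gt0.
exists (L * (1 + M)) => [|a f S hf S0 hS z zd]; first by rewrite mulr_gt0// ltr_pwDl.
have near w : r <= cabs w -> cabs w < 1 ->
    cabs (f w) <= L * S `^ p^-1 * (1 - cabs w) `^ (- c).
  move=> w1 w2; have w0 : 0 <= 1 - cabs w by rewrite subr_ge0 ltW.
  have h := hK a f S hf S0 hS w w1 w2.
  have -> : cabs (f w) = (cabs (f w) `^ p) `^ p^-1.
    by rewrite -powRrM divff ?gt_eqF// powRr1 ?cabs_ge0.
  have -> : L * S `^ p^-1 * (1 - cabs w) `^ (- c) =
      (K * S * (1 - cabs w) `^ (- (alpha + 2))) `^ p^-1.
    rewrite !powRM ?mulr_ge0 ?powR_ge0 ?(ltW K0)// -powRrM.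
    by congr (_ * _ `^ _); rewrite /c mulNr.
  by apply: ge0_ler_powR; rewrite ?nnegrE ?invr_ge0 ?(ltW p0) ?mulr_ge0 ?powR_ge0 ?(ltW K0).
have [zr|zr] := leP r (cabs z).
  apply: le_trans (near z zr zd) _; rewrite ler_wpM2r ?powR_ge0//.
  by rewrite ler_wpM2r ?powR_ge0// ler_peMr ?(ltW L0)// lerDl.
have z0 : 0 < 1 - cabs z by rewrite subr_gt0.
have hs w : cabs w = s -> cabs (f w) <= L * S `^ p^-1 * (1 - s) `^ (- c).
  by move=> ws; rewrite -ws; apply: near; rewrite ws// ltW.
apply: le_trans (maximum_principle_weak hf r0 rs s1 hs (ltW zr)) _.
rewrite -mulrA -/M.
apply: (@le_trans _ _ (L * (1 + M) * S `^ p^-1)).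
  rewrite mulrAC ler_wpM2r ?powR_ge0// ler_wpM2l ?(ltW L0)// lerDr //.
rewrite ler_peMr ?mulr_ge0 ?powR_ge0 ?(ltW L0) ?addr_ge0//.
have z1 : 1 - cabs z <= 1 by rewrite gerBl cabs_ge0.
by have := ler_powRN (ltW c0) z0 z1; rewrite powR1.
Qed.

Lemma box_average_ge0 (p alpha : R) f u : disk u -> (0 <= box_average p alpha f u)%E.
Proof.
move=> ud; apply: mule_ge0.
  by rewrite lee_fin invr_ge0 subr_ge0 expr_le1 ?cabs_ge0// ltW.
apply: mule_ge0; first by rewrite lee_fin invr_ge0 pi_ge0.
by apply: integral_ge0 => w _; rewrite lee_fin mulr_ge0 ?powR_ge0.
Qed.

Section TentNormProperties.
Variables (zeta p alpha : R).
Hypotheses (hz : 1 / 2 < zeta) (hp : 1 <= p).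

Let circle_measure := mrestr leb (measurable_itv `[0, 2 * (pi : R)]).

(* Beyond this radius every point belongs to some approach region. *)
Let radius : R := Num.max (1 / 2) (2 * zeta)^-1.

Let radius_half : 1 / 2 <= radius. Proof. by rewrite le_max lexx. Qed.

Let radius1 : radius < 1.
Proof.
rewrite gt_max; apply/andP; split; first lra.
have h : 1 < 2 * zeta by move: hz; lra.
by rewrite invf_lt1 ?(lt_trans ltr01 h).
Qed.

(** For |u| >= 1 / (2 zeta) the radial projection of u satisfies the inequality
that defines the region with room to spare, hence so does an arc next to it; an
arc is not negligible for the essential supremum. *)
Lemma Gamma_arc u : radius <= cabs u -> cabs u < 1 ->
  exists t0 t1 : R, [/\ 0 <= t0, t0 < t1, t1 <= 2 * pi &
    forall t, t0 <= t <= t1 -> Gamma zeta (cis t) u].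
Proof.
move=> u1 u2; have [t0 /andP[t00 t02] ut] := polar_form u.
have zr : 1 < zeta * (1 + cabs u).
  have : (2 * zeta)^-1 <= cabs u by apply: le_trans u1; rewrite le_max lexx orbT.
  rewrite -div1r ler_pdivrMr; last by move: hz; lra.
  move: hz; nra.
pose k := (zeta * (1 + cabs u) - 1) * (1 - cabs u).
have k0 : 0 < k by rewrite mulr_gt0// subr_gt0.
have pE : pi *+ 2 = 2 * pi :> R by rewrite mulr_natl.
exists t0, (Num.min (t0 + k / 2 / 2) (2 * pi)); split => //.
- by rewrite lt_min -pE t02 andbT ltrDl !divr_gt0.
- by rewrite ge_min lexx orbT.
move=> t /andP[ta]; rewrite le_min => /andP[tb _]; split => //.
rewrite {1}ut -[cis t]mul1r.
rewrite (_ : _ - _ = ((cabs u)%:C - 1) * cis t0 + (cis t0 - cis t)); last by ring.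
apply: le_lt_trans (cabsD _ _) _; rewrite cabsM cabs_cis mulr1.
have -> : cabs ((cabs u)%:C - 1) = 1 - cabs u.
  rewrite cabsB (_ : 1 - _ = (1 - cabs u)%:C); last by rewrite rmorphB.
  by rewrite cabs_real ger0_norm// subr_ge0 ltW.
have : cabs (cis t0 - cis t) <= `|t0 - t| + `|t0 - t|.
  apply: le_trans (cabs_le_ReIm _) _; apply: lerD.
    by rewrite ReD /=; exact: cos_lipschitz.
  by rewrite ImD /=; exact: sin_lipschitz.
rewrite ler0_norm; last by lra.
rewrite opprB => h; apply: le_lt_trans (lerD (lexx _) h) _.
apply: (@le_lt_trans _ _ (1 - cabs u + k / 2)); first by lra.
have -> : zeta * (1 - cabs u ^+ 2) = 1 - cabs u + k by rewrite /k; ring.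
by rewrite ltrD2l ltr_pdivrMr// ltr_pMr// ltr1n.
Qed.

Lemma box_average_le_ess_sup f u : radius <= cabs u -> cabs u < 1 ->
  (box_average p alpha f u <= circle_ess_sup (tent_sup zeta p alpha f))%E.
Proof.
move=> u1 u2; have [t0 [t1 [t00 t01 t12 hG]]] := Gamma_arc u1 u2.
have hae : {ae circle_measure, forall t,
    (tent_sup zeta p alpha f (cis t) <= circle_ess_sup (tent_sup zeta p alpha f))%E}.
  exact: (ess_sup_ge circle_measure (fun t => tent_sup zeta p alpha f (cis t))).
have [N [mN N0 sN]] := hae.
rewrite leNgt; apply/negP => hlt.
have sub : `[t0, t1]%classic `<=` N.
  move=> t; rewrite /= in_itv /= => ht; apply: sN => /=; apply/negP; rewrite -ltNge.
  apply: lt_le_trans hlt _; apply: ereal_sup_ubound; exists u => //.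
  exact: hG.
have : (leb `[t0, t1]%classic <= circle_measure N)%E.
  apply: le_measure; rewrite ?inE //; first exact: measurableI.
  move=> t ht; split; first exact: sub.
  move: ht; rewrite /= !in_itv /= => /andP[a b].
  by rewrite (le_trans t00 a) (le_trans b t12).
rewrite N0 lebesgue_measure_itv /= lte_fin t01 -EFinD lee_fin.
by rewrite leNgt subr_gt0 t01.
Qed.

Let ess_sup_ge0 f : (0 <= circle_ess_sup (tent_sup zeta p alpha f))%E.
Proof.
have r0 : 0 <= radius by apply: le_trans radius_half; lra.
have rE : cabs (radius%:C) = radius by rewrite cabs_real ger0_norm.
apply: le_trans (box_average_le_ess_sup f (u := radius%:C) _ _); rewrite ?rE//.
by apply: box_average_ge0; rewrite diskE rE.
Qed.

Lemma tent_norm_le f (S : R) : 0 <= S ->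
  (forall u, disk u -> (box_average p alpha f u <= S%:E)%E) ->
  (tent_norm zeta p alpha f <= (S `^ p^-1)%:E)%E.
Proof.
move=> S0 hS; rewrite /tent_norm -poweR_EFin; have p0 : 0 < p by apply: lt_le_trans hp.
have h : (circle_ess_sup (tent_sup zeta p alpha f) <= S%:E)%E.
  apply/ess_supP; apply: aeW => t; apply: ge_ereal_sup => _ [u [ud _] <-].
  exact: hS.
apply: gt0_ler_poweR => //; first by rewrite invr_ge0 ltW.
  by rewrite in_itv /= ess_sup_ge0 leey.
by rewrite in_itv /= lee_fin S0 leey.
Qed.

Lemma tent_norm_lty f : (tent_norm zeta p alpha f < +oo)%E ->
  exists2 S : R, 0 <= S & tent_norm zeta p alpha f = (S `^ p^-1)%:E /\
    forall u, radius <= cabs u -> cabs u < 1 -> (box_average p alpha f u <= S%:E)%E.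
Proof.
move=> hf; have p0 : 0 < p by apply: lt_le_trans hp.
have E0 := ess_sup_ge0 f.
have Ey : (circle_ess_sup (tent_sup zeta p alpha f) < +oo)%E.
  by apply: lty_poweRy hf; rewrite gt_eqF// invr_gt0.
have EE : circle_ess_sup (tent_sup zeta p alpha f) =
    (fine (circle_ess_sup (tent_sup zeta p alpha f)))%:E.
  by rewrite fineK// ge0_fin_numE.
exists (fine (circle_ess_sup (tent_sup zeta p alpha f))).
  by rewrite -lee_fin -EE.
split; first by rewrite /tent_norm {1}EE poweR_EFin.
by move=> u u1 u2; rewrite -EE; exact: box_average_le_ess_sup.
Qed.

Lemma tent_growth : - 2 < alpha ->
  exists2 A : R, 0 < A & forall a f, disk_expansion a f ->
    (tent_norm zeta p alpha f < +oo)%E -> forall z, disk z ->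
    cabs (f z) <= A * fine (tent_norm zeta p alpha f) *
      (1 - cabs z) `^ (- ((alpha + 2) / p)).
Proof.
move=> al; have [A A0 hA] := growth hp al radius_half radius1.
exists A => // a f hf /tent_norm_lty [S S0 [-> hS]] z zd.
exact: hA hf S0 hS z zd.
Qed.

End TentNormProperties.
End TentNorm.

(** * Moments of Carleson measures *)

Section Moments.
Local Open Scope complex_scope.
Context {R : realType}.
Local Notation C := (R[i]).
Variable mu : {finite_measure set (measurableTypeR R) -> \bar R}.
Local Notation I01 := (`[0, 1[%classic : set (measurableTypeR R)).

Let mI01 : measurable I01. Proof. exact: measurable_itv. Qed.

Let total := fine (mu I01).

Let totalE : mu I01 = total%:E.
Proof. by rewrite /total fineK// fin_num_measure. Qed.

Let integrable_exp n : mu.-integrable I01 (fun t => (t ^+ n)%:E).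
Proof.
apply: measurable_bounded_integrable => //.
- by have : (mu I01 < +oo)%E by rewrite totalE ltry.
exists 1; split; first exact: num_real.
move=> K K1 t /=; rewrite in_itv /= => /andP[t0 t1].
by rewrite ger0_norm ?exprn_ge0//; apply: le_trans (ltW K1); apply: exprn_ile1 => //; exact: ltW.
Qed.

Lemma momentE n : (moment mu n)%:E = (\int[mu]_(t in I01) (t ^+ n)%:E)%E.
Proof. by rewrite /moment /Rintegral fineK// integrable_fin_num. Qed.

Lemma moment_sum N (c : nat -> R) :
  (\sum_(n < N) c n * moment mu n)%:E =
  (\int[mu]_(t in I01) (\sum_(n < N) c n * t ^+ n)%:E)%E.
Proof.
under [RHS]eq_integral do rewrite -sumEFin.
rewrite integral_sum//.
  rewrite -sumEFin; apply: eq_bigr => n _; rewrite EFinM momentE -integralZl//.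
by move=> n; apply: (integrableZl mI01 (c n) (integrable_exp n)).
Qed.

Lemma moment_ge (t : R) n : 0 <= t -> t < 1 ->
  t ^+ n * fine (mu `[t, 1%R[%classic) <= moment mu n.
Proof.
move=> t0 t1; rewrite -lee_fin momentE EFinM fineK ?fin_num_measure//.
rewrite -[(_ * _)%E]integral_cst//.
apply: le_integral_nonneg => [x _|x|x] /=.
- by rewrite lee_fin exprn_ge0.
- by rewrite in_itv /= => /andP[x0 _]; rewrite lee_fin exprn_ge0.
rewrite in_itv /= => /andP[tx x1]; split; first by rewrite in_itv /= x1 (le_trans t0).
by rewrite lee_fin lerXn2r ?nnegrE// (le_trans t0).
Qed.

Lemma moment_norm_le n : `|moment mu n| <= total.
Proof.
rewrite ger0_norm; last first.
  by apply: Rintegral_ge0 => t /=; rewrite in_itv /= => /andP[t0 _]; rewrite exprn_ge0.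
rewrite -lee_fin momentE -totalE -[leRHS]mul1e -integral_cst//.
apply: le_integral_nonneg => [x|x _|x].
- by rewrite /= in_itv /= => /andP[x0 _]; rewrite lee_fin exprn_ge0.
- by rewrite /= lee_fin.
rewrite /= in_itv /= => /andP[x0 x1].
by rewrite ?x0 ?x1; split => //; rewrite lee_fin; apply: exprn_ile1 => //; exact: ltW.
Qed.

(** As for Lebesgue measure: 1 - t r is at least 1 - t and at least 1 - r. *)
Lemma carleson_integral_le (M q r : R) : 0 <= M -> 1 < q -> 0 <= r -> r < 1 ->
  (forall t : R, 0 <= t < 1 -> (mu `[t, 1%R[%classic <= (M * (1 - t))%:E)%E) ->
  (\int[mu]_(t in I01) ((1 - t * r) `^ (- q))%:E <=
   (2 `^ q / (1 - 2 / 2 `^ q) * M * (1 - r) `^ (1 - q))%:E)%E.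
Proof.
move=> M0 q1 r0 r1 hM; have d0 : 0 < 1 - r by rewrite subr_gt0.
apply: (@integral_powRN_large R _ _ mu I01 (fun t => 1 - t) (fun t => 1 - t * r)
  M (1 - r) q q1 d0 M0).
- move=> s; apply: measurableI => //; apply: measurable_le_set => //.
  exact: measurable_funB.
- move=> s s0; have [s1|s1] := leP s 1.
    have hs : 0 <= 1 - s < 1 by apply/andP; split; lra.
    have := hM _ hs; rewrite subKr; apply: le_trans.
    apply: le_measure; rewrite ?inE.
    + apply: measurableI => //; apply: measurable_le_set => //.
      exact: measurable_funB.
    + exact: measurable_itv.
    move=> t [] /=; rewrite !in_itv /= => /andP[t0 t1] h; rewrite t1 andbT; lra.
  have h0 : 0 <= (0 : R) < 1 by rewrite lexx ltr01.
  apply: (@le_trans _ _ (mu I01)).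
    apply: le_measure; rewrite ?inE //.
    apply: measurableI => //; apply: measurable_le_set => //.
    exact: measurable_funB.
  apply: le_trans (hM _ h0) _; rewrite lee_fin subr0.
  by rewrite ler_wpM2l// ltW.
- move=> t; rewrite /= in_itv /= => /andP[t0 t1]; split; nra.
Qed.

End Moments.

(** * The integral estimate for the Cesaro-like operator *)

Section Cesaro.
Local Open Scope complex_scope.
Context {R : realType}.
Local Notation C := (R[i]).
Variable mu : {finite_measure set (measurableTypeR R) -> \bar R}.
Implicit Types (a : nat -> C) (f : C -> C) (z : C).
Local Notation I01 := (`[0, 1[%classic : set (measurableTypeR R)).

Lemma cesaro_expansion a f : disk_expansion a f ->
  disk_expansion (fun n => (moment mu n)%:C * \sum_(k < n.+1) a k)
    (cesaro_like mu f).
Proof.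
move=> hf z zd; have ha := disk_expansion_subgeometric hf.
have hs := subgeometricM (subgeometric_partial_sums ha) (moment_norm_le mu).
have [l hl] := subgeometric_sum hs zd.
by rewrite /cesaro_like (taylor_coefE hf) (has_sum_lim hl).
Qed.

Lemma has_sum_partial_le (u : nat -> C) l (y K th : R) : has_sum u l ->
  0 <= th -> th < 1 -> (forall N, cabs (\sum_(k < N) u k) <= y + K * th ^+ N) ->
  cabs l <= y.
Proof.
move=> /has_sumP hu th0 th1 h; apply/ler_addgt0Pr => e e0.
have e2 : 0 < e / 2 by rewrite divr_gt0.
have [N1 h1] := hu _ e2; have [N2 h2] := geo_small K th0 th1 e2.
pose N := maxn N1 N2.
have hN1 := h1 N (leq_maxl _ _); have hN2 := h2 N (leq_maxr _ _).
rewrite -(subrK (\sum_(k < N) u k) l); apply: le_trans (cabsD _ _) _.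
by rewrite cabsB; have := h N; lra.
Qed.

Lemma one_sub_ge z (t : R) : 0 <= t ->
  1 - t * cabs z <= cabs (1 - t%:C * z).
Proof.
by move=> t0; have := cabs_distD 1 (t%:C * z); rewrite cabs1 cabsM cabs_real ger0_norm.
Qed.

Lemma one_sub_ge_Im z (t : R) : 0 <= t -> t <= 1 -> disk z ->
  `|complex.Im z| / 2 <= cabs (1 - t%:C * z).
Proof.
rewrite diskE => t0 t1 zd; have c0 := cabs_ge0 z; have hI := Im_le_cabs z.
have [th|th] := leP (1 / 2) t; last first.
  by apply: le_trans (one_sub_ge z t0); nra.
apply: le_trans (Im_le_cabs _); case: z {zd c0 hI} => x y /=.
rewrite mul0r addr0 add0r normrN normrM (ger0_norm t0) mulrC.
by rewrite ler_wpM2r//; lra.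
Qed.

(** The integral representation of the operator is used for partial sums only:
there it is the linearity of the integral, and the N-th partial sum of the
expansion of f (t z) / (1 - t z) is uniformly close to its limit in t. *)
Lemma cesaro_norm_le a f (B c b M : R) z : disk_expansion a f ->
  0 <= B -> 0 < b -> b < c -> b < 1 -> 0 <= M ->
  (forall z, disk z -> cabs (f z) <= B * (1 - cabs z) `^ (- c)) ->
  (forall t : R, 0 <= t < 1 -> (mu `[t, 1%R[%classic <= (M * (1 - t))%:E)%E) ->
  disk z -> complex.Im z != 0 ->
  cabs (cesaro_like mu f z) <=
    B * (`|complex.Im z| / 2) `^ (- b) *
    (2 `^ (c + 1 - b) / (1 - 2 / 2 `^ (c + 1 - b)) * M * (1 - cabs z) `^ (b - c)).
Proof.
move=> hf B0 b0 bc b1 M0 hB hM zd zI.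
have r0 := cabs_ge0 z; have r1 : cabs z < 1 := zd.
pose q := c + 1 - b; have q1 : 1 < q by rewrite /q; lra.
have hs := disk_expansion_partial_sums hf.
have [K [th [K0 th0 th1 htail]]] := disk_expansion_tail hs r0 r1.
have hint := carleson_integral_le M0 q1 r0 r1 hM.
rewrite -/q (_ : b - c = 1 - q); last by rewrite /q; ring.
set X := 2 `^ q / _ * M * _ in hint *.
pose m := fine (mu I01); have mE : mu I01 = m%:E by rewrite /m fineK// fin_num_measure.
apply: (has_sum_partial_le (K := K * m) (cesaro_expansion hf zd) th0 th1) => N.
set Y := B * _.
have Y0 : 0 <= Y by rewrite mulr_ge0 ?powR_ge0.
have [om om1 omE] := cabs_rot (\sum_(n < N)
   (moment mu n)%:C * (\sum_(k < n.+1) a k) * z ^+ n).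
pose r n := complex.Re (om * ((\sum_(k < n.+1) a k) * z ^+ n)).
have -> : cabs (\sum_(n < N) (moment mu n)%:C * (\sum_(k < n.+1) a k) * z ^+ n) =
    \sum_(n < N) r n * moment mu n.
  rewrite -omE mulr_sumr Re_sum; apply: eq_bigr => n _.
  by rewrite -mulrA mulrCA Re_realM mulrC.
rewrite -lee_fin moment_sum.
apply: le_trans (lee_abs _) _.
have mpoly : measurable_fun I01 (fun t : R => (\sum_(n < N) r n * t ^+ n)%:E).
  apply/measurable_EFinP; apply: measurable_sum => n.
  by apply: measurable_funM => //; apply: measurable_funX.
apply: le_trans (le_abse_integral _ _ _) _ => //.
apply: (@le_trans _ _ (\int[mu]_(t in I01)
   (Y%:E * ((1 - t * cabs z) `^ (- q))%:E + (K * th ^+ N)%:E))%E).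
  apply: le_integral_nonneg => [t _|t _|t tI] /=; first by [].
    by rewrite -EFinM -EFinD lee_fin addr_ge0 ?mulr_ge0 ?exprn_ge0 ?powR_ge0.
  split=> //; rewrite -EFinM -EFinD lee_fin.
  move: tI; rewrite /= in_itv /= => /andP[t0 t1].
  pose tz := t%:C * z.
  have tzr : cabs tz <= cabs z by rewrite cabsM cabs_real ger0_norm// ler_piMl// ltW.
  have tzE : cabs tz = t * cabs z by rewrite cabsM cabs_real ger0_norm.
  have -> : \sum_(n < N) r n * t ^+ n =
      complex.Re (om * \sum_(n < N) (\sum_(k < n.+1) a k) * tz ^+ n).
    rewrite mulr_sumr Re_sum; apply: eq_bigr => n _.
    rewrite /r mulrC -Re_realM rmorphXn /= /tz exprMn; congr complex.Re; ring.
  apply: le_trans (Re_le_cabs _) _; rewrite cabsM om1 mul1r.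
  set s := \sum_(n < N) _.
  rewrite -(subKr (f tz / (1 - tz)) s); apply: le_trans (cabsD _ _) _.
  rewrite cabsN; apply: lerD; last by apply: htail.
  rewrite cabsM cabsV.
  have w0 : 0 < 1 - t * cabs z by nra.
  have w1 : 1 - t * cabs z <= cabs (1 - tz) by exact: one_sub_ge.
  have w2 : `|complex.Im z| / 2 <= cabs (1 - tz) by apply: one_sub_ge_Im => //; exact: ltW.
  have y0 : 0 < `|complex.Im z| / 2 by rewrite divr_gt0// normr_gt0.
  have wc : 0 < cabs (1 - tz) by apply: lt_le_trans w1.
  have i1 : (cabs (1 - tz))^-1 <=
     (`|complex.Im z| / 2) `^ (- b) * (1 - t * cabs z) `^ (- (1 - b)).
    rewrite -powR_inv1 ?(ltW wc)// (_ : -1 = - b + - (1 - b)); last by ring.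
    rewrite powRD; last by rewrite (gt_eqF wc) implybT.
    by rewrite ler_pM ?powR_ge0// ler_powRN ?(ltW b0)//; lra.
  have tzd : disk tz by rewrite diskE; apply: le_lt_trans tzr r1.
  have i2 := hB _ tzd; rewrite tzE in i2.
  apply: le_trans (ler_pM _ _ i2 i1) _; rewrite ?cabs_ge0 ?invr_ge0 ?cabs_ge0//.
  rewrite mulrACA /Y ler_wpM2l// -powRD; last by rewrite (gt_eqF w0) implybT.
  by rewrite le_eqVlt; apply/orP; left; apply/eqP; congr (_ `^ _); rewrite /q; ring.
have mw : measurable_fun I01 (fun t : R => ((1 - t * cabs z) `^ (- q))%:E).
  apply: measurable_funTS; apply/measurable_EFinP.
  apply: measurableT_comp (measurable_powR _) _.
  by apply: measurable_funB => //; apply: measurable_funM.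
have KN0 : 0 <= K * th ^+ N by rewrite mulr_ge0 ?exprn_ge0.
have mI : measurable I01 by exact: measurable_itv.
rewrite ge0_integralD; [|exact: mI| | | |]; last 4 first.
- by move=> t _; rewrite -EFinM lee_fin mulr_ge0 ?powR_ge0.
- exact: emeasurable_funM.
- by move=> t _; rewrite lee_fin.
- exact: measurable_cst.
rewrite ge0_integralZl; [|exact: mI|exact: mw| |]; last 2 first.
- by move=> t _; rewrite lee_fin powR_ge0.
- by rewrite lee_fin.
rewrite integral_cst; last exact: mI.
rewrite (EFinD (Y * X)) (EFinM Y X); apply: leeD.
  by apply: lee_wpmul2l => //; rewrite lee_fin.
by rewrite [K * m * _]mulrAC (EFinM (K * th ^+ N) m) -mE; exact: lexx.
Qed.

End Cesaro.

(** * A sufficient condition for membership in the tent space *)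

Section Majorant.
Local Open Scope complex_scope.
Context {R : realType}.
Local Notation C := (R[i]).
Implicit Types (a : nat -> C) (f : C -> C) (z : C).

Lemma expansion_in_AT (zeta p alpha : R) a f : disk_expansion a f ->
  (tent_norm zeta p alpha f < +oo)%E -> analytic_tent_space zeta p alpha f.
Proof.
move=> hf hn; split; last exact: disk_expansion_analytic hf.
by split => //; exact: disk_expansion_measurable hf.
Qed.

(** Half of 1 - r^2 is at most 1 - r, and the first exponent is negative. *)
Lemma weight_le (alpha e r y : R) : 0 < e -> e < alpha + 2 -> 0 <= r -> r < 1 ->
  0 < y ->
  (1 - r) `^ (- (alpha + 2 - e)) * (y / 2) `^ (- e) * (1 - r ^+ 2) `^ (alpha + 1) <=
  2 `^ (alpha + 2) * ((1 - r ^+ 2) `^ (- (1 - e)) * y `^ (- e)).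
Proof.
move=> e0 ea r0 r1 y0; set v := 1 - r ^+ 2.
have v0 : 0 < v by rewrite /v; nra.
have vr : v / 2 <= 1 - r by rewrite /v; nra.
have d0 : 0 <= alpha + 2 - e by lra.
have v2 : 0 < v / 2 by rewrite divr_gt0.
have half (b : R) : (2^-1 : R) `^ (- b) = 2 `^ b.
  by rewrite -powR_inv1// -powRrM mulN1r opprK.
have h1 := ler_powRN d0 v2 vr.
rewrite powRM ?half ?(ltW v0)// in h1.
rewrite [(y / 2) `^ _]powRM ?half ?(ltW y0)//.
apply: (@le_trans _ _ (v `^ (- (alpha + 2 - e)) * 2 `^ (alpha + 2 - e) *
   (y `^ (- e) * 2 `^ e) * v `^ (alpha + 1))).
  by rewrite ler_wpM2r ?powR_ge0// ler_wpM2r ?mulr_ge0 ?powR_ge0.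
rewrite le_eqVlt; apply/orP; left; apply/eqP.
have -> : v `^ (- (1 - e)) = v `^ (- (alpha + 2 - e)) * v `^ (alpha + 1).
  by rewrite -powRD ?(gt_eqF v0) ?implybT//; congr (_ `^ _); ring.
have -> : 2 `^ (alpha + 2) = 2 `^ (alpha + 2 - e) * 2 `^ e.
  by rewrite -powRD ?pnatr_eq0 ?implybT//; congr (_ `^ _); ring.
ring.
Qed.

(** By [weight_le] the p-th power of such a bound, times the weight of the tent
space, has the form required by the box estimate. *)
Lemma tent_norm_majorant (zeta p alpha e : R) : 1 / 2 < zeta -> 1 <= p ->
  0 < e -> e < 1 -> e < alpha + 2 ->
  exists2 K : R, 0 < K & forall f (L : R), 0 <= L ->
    (forall z, disk z -> complex.Im z != 0 ->
       cabs (f z) <= L * ((1 - cabs z) `^ (- ((alpha + 2 - e) / p)) *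
                          (`|complex.Im z| / 2) `^ (- (e / p)))) ->
    (tent_norm zeta p alpha f <= (K * L)%:E)%E.
Proof.
move=> hz hp e0 e1 ea; have p0 : 0 < p by apply: lt_le_trans hp.
have [K0 K00 hK] := @box_integral_le R e e0 e1.
exists ((K0 * 2 `^ (alpha + 2)) `^ p^-1) => [|f L L0 hf].
  by rewrite powR_gt0// mulr_gt0// powR_gt0.
have -> : (K0 * 2 `^ (alpha + 2)) `^ p^-1 * L =
    (K0 * (2 `^ (alpha + 2) * L `^ p)) `^ p^-1.
  rewrite mulrA [RHS]powRM ?mulr_ge0 ?powR_ge0 ?(ltW K00)//.
  by rewrite -powRrM divff ?gt_eqF// powRr1.
have B0 : 0 <= 2 `^ (alpha + 2) * L `^ p by rewrite mulr_ge0 ?powR_ge0.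
apply: tent_norm_le => // [|u ud]; first by rewrite mulr_ge0// ltW.
apply: hK => // [z|z zd zI]; first by rewrite mulr_ge0 ?powR_ge0.
have c0 := cabs_ge0 z; have c1 : cabs z < 1 by [].
have y0 : 0 < `|complex.Im z| by rewrite normr_gt0.
have h1 : cabs (f z) `^ p <= L `^ p * ((1 - cabs z) `^ (- (alpha + 2 - e)) *
    (`|complex.Im z| / 2) `^ (- e)).
  have h := hf z zd zI.
  set X := L * _ in h; have X0 : 0 <= X by rewrite !mulr_ge0 ?powR_ge0.
  have {}h : cabs (f z) `^ p <= X `^ p.
    by apply: ge0_ler_powR => //; [exact: ltW|rewrite nnegrE cabs_ge0].
  apply: le_trans h _.
  rewrite /X !powRM ?mulr_ge0 ?powR_ge0// -!powRrM !mulNr !divfK ?gt_eqF//.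
apply: le_trans (ler_wpM2r (powR_ge0 _ _) h1) _.
rewrite -[leLHS]mulrA; have := weight_le e0 ea c0 c1 y0.
move=> /(ler_wpM2l (powR_ge0 L p)) h; apply: le_trans h _.
by rewrite mulrCA mulrA.
Qed.

End Majorant.

(** * Carleson measures give bounded operators *)

Section Sufficiency.
Local Open Scope complex_scope.
Context {R : realType}.
Local Notation C := (R[i]).
Variables (zeta p alpha : R).
Variable mu : {finite_measure set (measurableTypeR R) -> \bar R}.
Hypotheses (hz : 1 / 2 < zeta) (hp : 1 <= p) (ha : - 2 < alpha).

(* An exponent below both 1 and alpha + 2. *)
Let e : R := Num.min (alpha + 2) 1 / 2.

Let he : [/\ 0 < e, e < 1 & e < alpha + 2].
Proof.
have h : - 2 < alpha := ha.
rewrite /e; case: (leP (alpha + 2) 1) => h2; split; lra.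
Qed.

Let tent_norm_ge0 f : (0 <= tent_norm zeta p alpha f)%E.
Proof. exact: poweR_ge0. Qed.

Lemma carleson_bounded : carleson mu -> bounded_on_AT zeta p alpha (cesaro_like mu).
Proof.
move=> [M M0 hM]; have [e0 e1 ea] := he.
have p0 : 0 < p by apply: lt_le_trans hp.
have [K K0 hK] := tent_norm_majorant hz hp e0 e1 ea.
have [A A0 hA] := tent_growth hz hp ha.
pose c := (alpha + 2) / p; pose b := e / p; pose q := c + 1 - b.
have b0 : 0 < b by rewrite divr_gt0.
have bc : b < c by rewrite /b /c ltr_pM2r ?invr_gt0.
have b1 : b < 1 by rewrite /b ltr_pdivrMr// mul1r; apply: lt_le_trans hp.
pose Q : R := 2 `^ q / (1 - 2 / 2 `^ q).
have Q0 : 0 <= Q.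
  have Q2 : 2 < 2 `^ q :> R by rewrite -[ltLHS]powRr1// ltr_powR2// /q; lra.
  have h0 : 0 < 2 `^ q :> R by rewrite powR_gt0.
  by rewrite divr_ge0 ?(ltW h0)// subr_ge0 ler_pdivrMr// mul1r ltW.
exists (K * (A * Q * M)) => f [[_ fn] _].
have [[a hf]|nf] := pselect (exists a, disk_expansion a f); last first.
  (* The coefficient sequence is then the default one, 0, and so is the image;
     this settles the case without analytic continuation. *)
  have -> : cesaro_like mu f = fun=> 0.
    apply/funext => z; rewrite /cesaro_like.
    have -> : taylor_coef f = fun=> 0.
      by rewrite /taylor_coef xgetPN// => a ha'; apply: nf; exists a.
    apply: has_sum_lim; apply: eq_has_sum (@has_sum0 R) => n.
    by rewrite big1// mulr0 mul0r.
  have hn : (tent_norm zeta p alpha (fun=> (0 : C)%R) <= 0)%E.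
    have := hK (fun=> 0) 0 (lexx 0); rewrite mulr0; apply => z _ _.
    by rewrite mul0r cabs0.
  split.
    apply: (@expansion_in_AT _ _ _ _ (fun=> 0)); last by apply: le_lt_trans hn _.
    by move=> z _; apply: eq_has_sum (@has_sum0 R) => n; rewrite mul0r.
  apply: le_trans hn _; apply: mule_ge0 => //.
  rewrite lee_fin; apply: mulr_ge0; first exact: ltW.
  by apply: mulr_ge0; [apply: mulr_ge0 => //; exact: ltW|exact: ltW].
have gr := hA a f hf fn.
set N := fine (tent_norm zeta p alpha f) in gr.
have NE : tent_norm zeta p alpha f = N%:E by rewrite /N fineK// ge0_fin_numE.
have N0 : 0 <= N by rewrite -lee_fin -NE.
have B0 : 0 <= A * N by rewrite mulr_ge0// ltW.
have bound : (tent_norm zeta p alpha (cesaro_like mu f) <= (K * (A * N * (Q * M)))%:E)%E.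
  apply: hK => [|z zd zI].
    by apply: mulr_ge0 => //; apply: mulr_ge0 => //; exact: ltW.
  have := cesaro_norm_le hf B0 b0 bc b1 (ltW M0) gr hM zd zI.
  rewrite -/q -/Q => h; apply: le_trans h _; rewrite le_eqVlt; apply/orP; left; apply/eqP.
  have -> : - ((alpha + 2 - e) / p) = b - c by rewrite /b /c; field; rewrite gt_eqF.
  rewrite -/b; ring.
split; first exact: (expansion_in_AT (cesaro_expansion hf) (le_lt_trans bound (ltry _))).
by apply: le_trans bound _; rewrite NE -EFinM lee_fin le_eqVlt; apply/orP; left; apply/eqP; ring.
Qed.

End Sufficiency.

(** * Test functions *)

Section TestFunctions.
Local Open Scope complex_scope.
Context {R : realType}.
Local Notation C := (R[i]).
Implicit Types (a : nat -> C) (f : C -> C) (z : C).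

(** Taylor coefficients of (1 - z)^(-s): each factor 1 / (1 - z) takes partial
sums. *)
Fixpoint neg_binomial (s n : nat) : R :=
  if s is s'.+1 then \sum_(k < n.+1) neg_binomial s' k else (n == 0)%:R.

Lemma neg_binomial_ge0 s n : 0 <= neg_binomial s n.
Proof.
by elim: s n => [|s IH] n //=; apply: sumr_ge0 => k _; exact: IH.
Qed.

Lemma neg_binomial_expansion s :
  disk_expansion (fun n => (neg_binomial s n)%:C) (fun z => (1 - z) ^- s).
Proof.
elim: s => [|s IH] z zd.
  rewrite expr0 invr1; apply/has_sumP => e e0; exists 1%N => -[//|n] _.
  rewrite big_ord_recl big1; last by move=> i _ /=; rewrite mul0r.
  rewrite (_ : neg_binomial 0 _ = 1)// expr0 mulr1 addr0.
  by rewrite (_ : 1%:C - 1 = 0 :> C) ?cabs0// subrr.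
have := disk_expansion_partial_sums IH zd.
rewrite exprSr invfM; apply: eq_has_sum => n /=; congr (_ * _).
by rewrite rmorph_sum.
Qed.

Lemma disk_expansion_dilate a f (k : C) (t : R) : disk_expansion a f ->
  0 <= t -> t <= 1 ->
  disk_expansion (fun n => k * (a n * t%:C ^+ n)) (fun z => k * f (t%:C * z)).
Proof.
move=> hf t0 t1 z zd.
have tzd : disk (t%:C * z).
  rewrite diskE cabsM cabs_real ger0_norm//; apply: le_lt_trans zd.
  by rewrite ler_piMl ?cabs_ge0.
have := has_sumZ (c := k) (hf _ tzd); apply: eq_has_sum => n.
by rewrite exprMn !mulrA.
Qed.

Lemma has_sum_Re_le (u v : nat -> C) l m : has_sum u l -> has_sum v m ->
  (forall n, complex.Re (v n) <= complex.Re (u n)) -> complex.Re m <= complex.Re l.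
Proof.
move=> /has_sumP hu /has_sumP hv uv; apply/ler_addgt0Pr => e e0.
have e2 : 0 < e / 2 by rewrite divr_gt0.
have [N1 h1] := hu _ e2; have [N2 h2] := hv _ e2.
pose N := maxn N1 N2.
have := le_lt_trans (Re_le_cabs _) (h1 N (leq_maxl _ _)).
have := le_lt_trans (Re_le_cabs _) (h2 N (leq_maxr _ _)).
rewrite !ReD !Re_sum.
have -> : complex.Re (- l) = - complex.Re l by case: (l).
have -> : complex.Re (- m) = - complex.Re m by case: (m).
have : \sum_(i < N) complex.Re (v i) <= \sum_(i < N) complex.Re (u i).
  by apply: ler_sum => i _.
rewrite !ltr_norml => h /andP[h3 h4] /andP[h5 h6]; lra.
Qed.

End TestFunctions.

(** * Bounded operators come from Carleson measures *)

Section Necessity.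
Local Open Scope complex_scope.
Context {R : realType}.
Local Notation C := (R[i]).
Variables (zeta p alpha : R).
Variable mu : {finite_measure set (measurableTypeR R) -> \bar R}.
Hypotheses (hz : 1 / 2 < zeta) (hp : 1 <= p) (ha : - 2 < alpha).

Let c : R := (alpha + 2) / p.

Let c0 : 0 < c.
Proof.
have p0 : 0 < p by apply: lt_le_trans hp.
by rewrite divr_gt0//; move: ha; lra.
Qed.

Let s : nat := Num.bound c.

Let cs : c < s%:R. Proof. by apply: archi_boundP; exact: ltW. Qed.

(* (1 - t)^(s-c) (1 - t z)^(-s), normalized to be dominated by |1 - t z|^(-c). *)
Let test (t : R) (z : C) : C := ((1 - t) `^ (s%:R - c))%:C * (1 - t%:C * z) ^- s.

Let coef (t : R) (n : nat) : R := (1 - t) `^ (s%:R - c) * (neg_binomial s n * t ^+ n).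

Let coef_ge0 t n : 0 <= t -> 0 <= coef t n.
Proof. by move=> t0; rewrite mulr_ge0 ?powR_ge0 ?mulr_ge0 ?neg_binomial_ge0 ?exprn_ge0. Qed.

Let test_expansion t : 0 <= t -> t < 1 ->
  disk_expansion (fun n => (coef t n)%:C) (test t).
Proof.
move=> t0 t1.
have := disk_expansion_dilate (k := ((1 - t) `^ (s%:R - c))%:C) (@neg_binomial_expansion R s)
  t0 (ltW t1).
by congr disk_expansion; apply/funext => n; rewrite /coef !rmorphM rmorphXn.
Qed.

Let test_norm_le t z : 0 <= t -> t < 1 -> disk z ->
  cabs (test t z) <= cabs (1 - t%:C * z) `^ (- c).
Proof.
move=> t0 t1 zd; have := one_sub_ge z t0; set w := cabs (1 - _) => h.
have z1 : cabs z < 1 by [].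
have h1 : 1 - t <= w by apply: le_trans h; have := cabs_ge0 z; nra.
have t1' : 0 < 1 - t by rewrite subr_gt0.
have w0 : 0 < w by apply: lt_le_trans h1.
rewrite cabsM cabsV cabsX -/w cabs_real ger0_norm ?powR_ge0//.
have sc : 0 <= s%:R - c by rewrite subr_ge0 ltW.
apply: (@le_trans _ _ (w `^ (s%:R - c) * w ^- s)).
  rewrite ler_wpM2r ?invr_ge0 ?exprn_ge0 ?(ltW w0)//.
  by rewrite ge0_ler_powR// nnegrE ltW.
rewrite -powR_invn ?(ltW w0)// -powRD; last by rewrite (gt_eqF w0) implybT.
by rewrite (_ : s%:R - c + _ = - c)//; ring.
Qed.

Lemma test_functions_bounded : exists2 D : R, 0 < D & forall t, 0 <= t -> t < 1 ->
  (tent_norm zeta p alpha (test t) <= D%:E)%E.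
Proof.
have p0 : 0 < p by apply: lt_le_trans hp.
have [e [e0 e1 ea]] : exists e : R, [/\ 0 < e, e < 1 & e < alpha + 2].
  exists (Num.min (alpha + 2) 1 / 2); have h := ha.
  by case: (leP (alpha + 2) 1) => h2; split; lra.
have [K K0 hK] := tent_norm_majorant hz hp e0 e1 ea.
exists K => // t t0 t1; rewrite -[K]mulr1; apply: hK => // z zd zI.
rewrite mul1r; apply: le_trans (test_norm_le t0 t1 zd) _.
have r1 : cabs z < 1 by [].
have h1 : 1 - cabs z <= cabs (1 - t%:C * z).
  by apply: le_trans (one_sub_ge z t0); have := cabs_ge0 z; nra.
have h2 := one_sub_ge_Im t0 (ltW t1) zd.
set w := cabs (1 - t%:C * z) in h1 h2 *.
have w1 : 0 < 1 - cabs z by rewrite subr_gt0.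
have w0 : 0 < w by apply: lt_le_trans h1.
have -> : - c = - ((alpha + 2 - e) / p) + - (e / p).
  by rewrite /c; field; rewrite gt_eqF.
rewrite powRD; last by rewrite (gt_eqF w0) implybT.
apply: ler_pM; rewrite ?powR_ge0//; apply: ler_powRN => //.
- by rewrite divr_ge0 ?(ltW p0)//; lra.
- by rewrite divr_ge0 ?(ltW p0)// ltW.
- by rewrite divr_gt0// normr_gt0.
Qed.

(** Replacing the moments by their lower bounds t^n mu([t, 1)) turns the series
of the image at t into that of f (z) / (1 - z) at t^2. *)
Lemma cesaro_test_ge t : 0 <= t -> t < 1 ->
  fine (mu `[t, 1%R[%classic) * (3 ^- s / 2 * (1 - t) `^ (- c - 1)) <=
  complex.Re (cesaro_like mu (test t) t%:C).
Proof.
move=> t0 t1; have t1' : 0 < 1 - t by rewrite subr_gt0.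
have hf := test_expansion t0 t1.
have td : disk t%:C by rewrite diskE cabs_real ger0_norm.
have td2 : disk (t ^+ 2)%:C by rewrite diskE cabs_real ger0_norm ?sqr_ge0// expr_lt1.
set m := fine _; have m0 : 0 <= m by rewrite fine_ge0.
have h1 := cesaro_expansion (mu := mu) hf td.
have h2 := has_sumZ (c := m%:C) (disk_expansion_partial_sums hf td2).
have := has_sum_Re_le h1 h2; set X := complex.Re (m%:C * _) => hX.
apply: (@le_trans _ _ X); last first.
  apply: hX => n; rewrite -rmorph_sum -!rmorphXn. rewrite -[X in _ <= complex.Re X]mulrA !Re_realM /=.
  set S := \sum_(k < n.+1) _.
  have S0 : 0 <= S by apply: sumr_ge0 => k _; exact: coef_ge0.
  have := moment_ge mu n t0 t1; rewrite -/m => hm.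
  have := ler_wpM2r (mulr_ge0 S0 (exprn_ge0 n t0)) hm.
  rewrite -exprM mulnC exprM; lra.
rewrite /X Re_realM ler_wpM2l// /test.
have -> : ((1 - t) `^ (s%:R - c))%:C * (1 - t%:C * (t ^+ 2)%:C) ^- s / (1 - (t ^+ 2)%:C) =
   ((1 - t) `^ (s%:R - c) * (1 - t ^+ 3) ^- s / (1 - t ^+ 2))%:C :> C.
  have e3 : 1 - t%:C * (t ^+ 2)%:C = (1 - t ^+ 3)%:C :> C.
    by rewrite [t ^+ 3]exprS !(rmorphB, rmorphM, rmorph1).
  have e2 : 1 - (t ^+ 2)%:C = (1 - t ^+ 2)%:C :> C by rewrite rmorphB.
  by rewrite e3 e2 -rmorphXn -!fmorphV -!rmorphM.
rewrite [leRHS]/=.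
have a3 : 0 < 1 - t ^+ 3 by rewrite subr_gt0 exprn_ilt1.
have a2 : 0 < 1 - t ^+ 2 by rewrite subr_gt0 exprn_ilt1.
have b3 : 1 - t ^+ 3 <= 3 * (1 - t) by rewrite exprS; nra.
have b2 : 1 - t ^+ 2 <= 2 * (1 - t) by nra.
have i3 : (3 * (1 - t)) ^- s <= (1 - t ^+ 3) ^- s.
  rewrite lef_pV2 ?posrE ?exprn_gt0 ?mulr_gt0// lerXn2r ?nnegrE// ?(ltW a3)//.
  by rewrite mulr_ge0// ltW.
have i2 : (2 * (1 - t))^-1 <= (1 - t ^+ 2)^-1.
  by rewrite lef_pV2 ?posrE// mulr_gt0.
rewrite -[leRHS]mulrA.
apply: (@le_trans _ _ ((1 - t) `^ (s%:R - c) * ((3 * (1 - t)) ^- s * (2 * (1 - t))^-1))).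
  rewrite (_ : - c - 1 = (s%:R - c) + (- s%:R + -1)); last by ring.
  have tE (x y : R) : (1 - t) `^ (x + y) = (1 - t) `^ x * (1 - t) `^ y.
    by rewrite powRD// (gt_eqF t1') implybT.
  rewrite !tE powR_invn ?(ltW t1')// powR_inv1 ?(ltW t1')//.
  rewrite exprMn !invfM le_eqVlt; apply/orP; left; apply/eqP; ring.
rewrite ler_wpM2l ?powR_ge0// ler_pM ?invr_ge0 ?exprn_ge0 ?mulr_ge0 ?(ltW t1')//.
Qed.

Lemma bounded_carleson : bounded_on_AT zeta p alpha (cesaro_like mu) -> carleson mu.
Proof.
move=> [M hM]; have [D D0 hD] := test_functions_bounded.
have [A A0 hA] := tent_growth hz hp ha.
exists (3 ^+ s * 2 * (A * (`|M| * D)) + 1) => [|t /andP[t0 t1]].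
  by rewrite ltr_wpDl// !mulr_ge0 ?exprn_ge0 ?(ltW A0) ?(ltW D0).
have t1' : 0 < 1 - t by rewrite subr_gt0.
have hf := test_expansion t0 t1.
have fn := le_lt_trans (hD t t0 t1) (ltry _).
have [_ hT] := hM _ (expansion_in_AT hf fn).
have td : disk (t%:C : C) by rewrite diskE cabs_real ger0_norm.
have hn : (tent_norm zeta p alpha (cesaro_like mu (test t)) <= (`|M| * D)%:E)%E.
  apply: le_trans hT _; rewrite EFinM.
  apply: (@le_trans _ _ (`|M|%:E * tent_norm zeta p alpha (test t))%E).
    by rewrite lee_wpmul2r ?poweR_ge0// lee_fin ler_norm.
  by rewrite lee_wpmul2l// ?lee_fin// hD.
have Tn := le_lt_trans hn (ltry _).
have := hA _ _ (cesaro_expansion (mu := mu) hf) Tn _ td.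
rewrite cabs_real (ger0_norm t0) => g1.
have n0 : (0 <= tent_norm zeta p alpha (cesaro_like mu (test t)))%E by exact: poweR_ge0.
have g2 : fine (tent_norm zeta p alpha (cesaro_like mu (test t))) <= `|M| * D.
  by rewrite -lee_fin fineK// ge0_fin_numE.
have g3 := cesaro_test_ge t0 t1.
have g4 := le_trans (ler_norm _) (Re_le_cabs (cesaro_like mu (test t) t%:C)).
set m := fine _ in g3.
have mE : mu `[t, 1%R[%classic = m%:E by rewrite /m fineK// fin_num_measure.
rewrite -[X in (X <= _)%E]/(mu `[t, 1%R[%classic) mE lee_fin.
pose P := (1 - t) `^ (- c); have P0 : 0 < P by rewrite powR_gt0.
have PE : (1 - t) `^ (- c - 1) = P / (1 - t).
  by rewrite powRD ?(gt_eqF t1') ?implybT// powR_inv1 ?(ltW t1').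
have g5 : m * (3 ^- s / 2 * (P / (1 - t))) <= A * (`|M| * D) * P.
  rewrite -PE; apply: le_trans g3 (le_trans g4 (le_trans g1 _)).
  by rewrite ler_wpM2r ?powR_ge0// ler_wpM2l ?(ltW A0).
have s3 : 0 < 3 ^+ s :> R by rewrite exprn_gt0.
have g6 : m <= 3 ^+ s * 2 * (A * (`|M| * D)) * (1 - t).
  rewrite -(ler_pM2r P0).
  have -> : m * P = (3 ^+ s * 2 * (1 - t)) * (m * (3 ^- s / 2 * (P / (1 - t)))).
    by field; rewrite !gt_eqF.
  have -> : 3 ^+ s * 2 * (A * (`|M| * D)) * (1 - t) * P =
      (3 ^+ s * 2 * (1 - t)) * (A * (`|M| * D) * P) by ring.
  by rewrite ler_wpM2l// !mulr_ge0// ltW.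
apply: le_trans g6 _; rewrite ler_wpM2r ?(ltW t1')// lerDl //.
Qed.

End Necessity.

(** * The equivalence *)

Theorem theorem4p7 (R : realType) (zeta p alpha : R)
  (mu : {finite_measure set (measurableTypeR R) -> \bar R})
  (hzeta : 1 / 2 < zeta) (hp : 1 <= p) (halpha : - 2 < alpha)
  (hmu : mu (~` [set t : R | 0 <= t < 1]) = 0%E) :
  bounded_on_AT zeta p alpha (cesaro_like mu) <-> carleson mu.
Proof.
split; first exact: bounded_carleson.
exact: carleson_bounded.
Qed.
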